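(* Consider the two-tubes IPM equations (defined in the context) with parameter $l>0$. There exists $l_0>0$ such that for every $l\in(0,l_0)$ there exists a propagating terrace consisting of two traveling waves, with speeds $v_1^*(l)\le v_2^*(l)$, connecting the states $$\sigma_0=(-1,-1,0,0,0),\qquad \sigma_1=(c_1^*(l),c_2^*(l),u_1^*(l),u_2^*(l),0),\qquad \sigma_2=(1,1,0,0,0)$$ (that is, a traveling wave of speed $v_1^*(l)$ connecting $\sigma_0$ to $\sigma_1$ and a traveling wave of speed $v_2^*(l)$ connecting $\sigma_1$ to $\sigma_2$), for some real numbers $c_1^*(l),c_2^*(l),u_1^*(l),u_2^*(l)$ with $\sigma_1$ a stationary solution. Moreover, $$\lim_{l\to0}c_1^*(l)=-\lim_{l\to0}c_2^*(l)=\tfrac12,\qquad \lim_{l\to0}v_2^*(l)=-\lim_{l\to0}v_1^*(l)=\tfrac14 .$$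
   Context: Two-tubes IPM equations with parameter $l>0$: unknowns $c_1,c_2,u_1,u_2,q$, real functions of $(t,y)\in[0,\infty)\times\mathbb{R}$, satisfying $$\partial_t c_1+\partial_y(u_1c_1)-\partial_{yy}c_1=-f,\qquad \partial_t c_2+\partial_y(u_2c_2)-\partial_{yy}c_2=f,$$ $$\partial_y q=u_1-u_2+c_1-c_2,\qquad \partial_y u_1=\frac{q}{l^2},\qquad u_1+u_2=0,$$ where, with $u_T:=-q/l$, $f=\frac{u_T}{l}c_1$ if $u_T\ge0$ and $f=\frac{u_T}{l}c_2$ if $u_T\le 0$. A traveling wave with speed $v\in\mathbb{R}$ connecting states $g_-,g_+\in\mathbb{R}^5$ is a solution of the form $(c_1,c_2,u_1,u_2,q)(t,y)=\tilde g(y-vt)$ with $\tilde g:\mathbb{R}\to\mathbb{R}^5$ continuous (and smooth enough to solve the equations classically), $\tilde g(-\infty)=g_-$, $\tilde g(+\infty)=g_+$. A propagating terrace connecting $\alpha\in\mathbb{R}^5$ to $\beta\in\mathbb{R}^5$ is a pair of finite sequences $(\sigma_k)_{0\le k\le N}$, $(g_k)_{1\le k\le N}$ such that each $\sigma_k\in\mathbb{R}^5$ is a stationary (constant) solution of the equations, $\sigma_0=\alpha$, $\sigma_N=\beta$, each $g_k$ is a traveling wave connecting $\sigma_{k-1}$ to $\sigma_k$ with speed $v_k$, and $v_1\le v_2\le\dots\le v_N$. *)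

(* Defs.v *)
From Stdlib Require Import Reals.
From Coquelicot Require Import Coquelicot.
Open Scope R_scope.

Record state5 := mkState { sc1 : R; sc2 : R; su1 : R; su2 : R; sq : R }.

Definition dt (F : R -> R -> R) (t y : R) : R := Derive (fun s => F s y) t.
Definition dy (F : R -> R -> R) (t y : R) : R := Derive (fun z => F t z) y.

Definition fterm (l c1 c2 q : R) : R :=
  let uT := - q / l in
  if Rle_dec 0 uT then uT / l * c1 else uT / l * c2.

Definition is_solution (l : R) (c1 c2 u1 u2 q : R -> R -> R) : Prop :=
  forall t y, 0 <= t ->
    (* regularity needed for the equations to make sense classically *)
    ex_derive (fun s => c1 s y) t /\ ex_derive (fun s => c2 s y) t /\
    ex_derive (fun z => c1 t z) y /\ ex_derive (fun z => c2 t z) y /\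
    ex_derive (fun z => dy c1 t z) y /\ ex_derive (fun z => dy c2 t z) y /\
    ex_derive (fun z => u1 t z * c1 t z) y /\
    ex_derive (fun z => u2 t z * c2 t z) y /\
    ex_derive (fun z => q t z) y /\ ex_derive (fun z => u1 t z) y /\
    dt c1 t y + dy (fun s z => u1 s z * c1 s z) t y - dy (dy c1) t y
      = - fterm l (c1 t y) (c2 t y) (q t y) /\
    dt c2 t y + dy (fun s z => u2 s z * c2 s z) t y - dy (dy c2) t y
      = fterm l (c1 t y) (c2 t y) (q t y) /\
    dy q t y = u1 t y - u2 t y + c1 t y - c2 t y /\
    dy u1 t y = q t y / l ^ 2 /\
    u1 t y + u2 t y = 0.

Definition tw_field (g : R -> state5) (v : R) (proj : state5 -> R) : R -> R -> R :=
  fun t y => proj (g (y - v * t)).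

Definition stationary (l : R) (s : state5) : Prop :=
  is_solution l (fun _ _ => sc1 s) (fun _ _ => sc2 s) (fun _ _ => su1 s)
    (fun _ _ => su2 s) (fun _ _ => sq s).

Definition state_lim (g : R -> state5) (x : Rbar) (s : state5) : Prop :=
  is_lim (fun z => sc1 (g z)) x (sc1 s) /\ is_lim (fun z => sc2 (g z)) x (sc2 s) /\
  is_lim (fun z => su1 (g z)) x (su1 s) /\ is_lim (fun z => su2 (g z)) x (su2 s) /\
  is_lim (fun z => sq (g z)) x (sq s).

Definition traveling_wave (l : R) (g : R -> state5) (v : R) (gm gp : state5) : Prop :=
  (forall z, continuous (fun x => sc1 (g x)) z /\ continuous (fun x => sc2 (g x)) z /\
             continuous (fun x => su1 (g x)) z /\ continuous (fun x => su2 (g x)) z /\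
             continuous (fun x => sq (g x)) z) /\
  is_solution l (tw_field g v sc1) (tw_field g v sc2) (tw_field g v su1)
    (tw_field g v su2) (tw_field g v sq) /\
  state_lim g m_infty gm /\ state_lim g p_infty gp.

Definition propagating_terrace (l : R) (N : nat) (sigma : nat -> state5)
    (g : nat -> R -> state5) (v : nat -> R) (alpha beta : state5) : Prop :=
  (forall k, (k <= N)%nat -> stationary l (sigma k)) /\
  sigma 0%nat = alpha /\ sigma N = beta /\
  (forall k, (1 <= k <= N)%nat -> traveling_wave l (g k) (v k) (sigma (k - 1)%nat) (sigma k)) /\
  (forall k, (1 <= k < N)%nat -> v k <= v (S k)).

(* Main.v *)
Require Import Defs.
From Stdlib Require Import Reals Lra Lia Classical ClassicalEpsilon.
From Coquelicot Require Import Coquelicot.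
Open Scope R_scope.

(** Traveling-wave coordinates are scaled so that the first wave has speed [-1],
    and [w = -u1 >= 0].  As long as [u1] decreases, the profile equations read
    [p' = (1 - w) p] for [p = c1'], [d' = 2 Th p] for [d = c1 - c2], with
    [Th' = 2 w Th - w + (d / 2) th] where [w' = th p], and
    [w - kap^2 w'' = d / 2].  When [kap = 0] this forces [th = Th = 1/3], and the
    wave is the explicit logistic [w = 2 ell], [c1 + 1 = 6 ell].

    For [kap > 0] put [th = (al + be) / 2] and [defect = kap (al - be) / 2], where
    [al], [be] solve first-order relaxation equations (the two one-sided halves of
    [(1 - kap^2 d^2/dx^2)^(-1)], divided by [p]).  Then [w = F - defect p] with
    [F' = Th p], and [y = 2 (Th - 1/3 + w defect)] solves
    [y' = 3 w y - defect (2 w + 4 w^2 - 4 p th)].  The only terms not controlled by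
    a Volterra operator carry the factor [defect = O(kap)], so in a suitably
    weighted sup norm this is a contraction of the pair [(w, Th)] near
    [(2 ell, 1/3)].  The scaling symmetry lets [kap = k / S] depend on the unknown
    ([l = sqrt 2 k], and [2 S] is the total increment of [c1 + c2]); undoing it
    by the factor [1 / S] makes [c1 + c2] vanish at [+oo].  The reflection [y -> -y, c1 <-> -c2] then
    maps the first wave to the second. *)

(** The limit [kap -> 0] is singular: [al] and [be] are only confined to [[0, 1]], and nothing makes
    [th - Th] small beforehand. Since [d / 2 = F = w + defect p], the equation of [Th] reads [Th' =
    3 w Th - w + w (th - Th) + defect p th], whose third term is a priori of order one. It is
    integrated by parts: by [(defect p)' = (Th - th) p] it is minus the derivative of [w defect]
    plus terms with the factor [defect]. This is the origin of the correction inside [y] and of the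
    quadratic source. The equation of [y] is unstable to the right, so its bounded solution is
    selected at [+oo]; every term of its source is [O(w)], hence the coefficient [3 w] absorbs it
    even near [-oo], where [w] decays. What stays of order one is the dependence of [F] on [w]
    through [p], a Volterra dependence started at [-oo]. An exponential weight makes it contractive,
    at the price of the huge constant [wt_max], whence the tiny range of [l]. Letting [kap] depend
    on [S] spares a separate equation for the scaling, but successive iterates then carry different
    [kap], and the relaxation equations have to be compared across them. *)

(** * Monotonicity, primitives and limits at infinity *)

Lemma nondecreasing_of_derive (f df : R -> R) :
  (forall x, is_derive f x (df x)) -> (forall x, 0 <= df x) ->
  forall x y, x <= y -> f x <= f y.
Proof.
  intros Hd Hp x y Hxy.
  destruct (MVT_gen f x y df) as [c [_ Hc]].
  - intros z _. apply Hd.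
  - intros z _. apply continuity_pt_filterlim.
    apply (ex_derive_continuous f z). exists (df z). apply Hd.
  - assert (0 <= df c * (y - x)) by (apply Rmult_le_pos; [apply Hp | lra]). lra.
Qed.

Lemma continuous_of_derive (f : R -> R) (x l : R) : is_derive f x l -> continuous f x.
Proof. intro H. apply (ex_derive_continuous f x). now exists l. Qed.

Lemma ex_primitive (f : R -> R) :
  (forall x, continuous f x) -> exists F, forall x, is_derive F x (f x).
Proof.
  intro Hf. exists (fun x => RInt f 0 x). intro x.
  apply (is_derive_RInt f (fun x => RInt f 0 x) 0 x).
  - exists (mkposreal 1 Rlt_0_1). intros z _.
    apply (@RInt_correct R_CompleteNormedModule).
    apply (@ex_RInt_continuous R_CompleteNormedModule). intros; apply Hf.
  - apply Hf.
Qed.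

(* Since [I + G] and [G - I] are nondecreasing and [G >= 0], the supremum of
   [I - G] is finite and lies between [I x - G x] and [I x + G x] for every [x]. *)
Lemma dominated_primitive (f g G : R -> R) :
  (forall x, continuous f x) -> (forall x, is_derive G x (g x)) ->
  (forall x, 0 <= G x) -> (forall x, Rabs (f x) <= g x) ->
  exists F, (forall x, is_derive F x (f x)) /\ (forall x, Rabs (F x) <= G x).
Proof.
  intros Hf HG HG0 Hfg.
  destruct (ex_primitive f Hf) as [I HI].
  assert (Hp : forall x y, x <= y -> I x + G x <= I y + G y).
  { apply (nondecreasing_of_derive (fun x => I x + G x) (fun x => f x + g x)).
    - intro x. apply (is_derive_plus (K := R_AbsRing) (V := R_NormedModule) I G); auto.
    - intro x. specialize (Hfg x). apply Rabs_le_between in Hfg. lra. }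
  assert (Hm : forall x y, x <= y -> G x - I x <= G y - I y).
  { apply (nondecreasing_of_derive (fun x => G x - I x) (fun x => g x - f x)).
    - intro x. apply (is_derive_minus (K := R_AbsRing) (V := R_NormedModule) G I); auto.
    - intro x. specialize (Hfg x). apply Rabs_le_between in Hfg. lra. }
  assert (Hub : forall x z, I z - G z <= I x + G x).
  { intros x z. destruct (Rle_dec x z) as [H|H].
    - specialize (Hm x z H). pose proof (HG0 x). lra.
    - specialize (Hp z x). pose proof (HG0 z). lra. }
  destruct (completeness (fun r => exists z, r = I z - G z)) as [L [HL1 HL2]].
  - exists (I 0 + G 0). intros r [z ->]. apply Hub.
  - exists (I 0 - G 0). now exists 0.
  - exists (fun x => I x - L). split.
    + intro x. replace (f x) with (minus (f x) zero) by (unfold minus, plus, opp, zero; simpl; ring).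
      apply (is_derive_minus (K := R_AbsRing) (V := R_NormedModule) I (fun _ => L)); auto.
      apply (is_derive_const (K := R_AbsRing) (V := R_NormedModule)).
    + intro x.
      assert (I x - G x <= L) by (apply HL1; now exists x).
      assert (L <= I x + G x) by (apply HL2; intros r [z ->]; apply Hub).
      apply Rabs_le. lra.
Qed.

Lemma nonneg_of_lim_m_infty (f : R -> R) :
  (forall x y, x <= y -> f x <= f y) -> is_lim f m_infty 0 -> forall x, 0 <= f x.
Proof.
  intros Hi Hl x.
  apply (is_lim_le_loc f (fun _ => f x) m_infty 0 (f x)).
  - exists x. intros y Hy. apply Hi. lra.
  - exact Hl.
  - apply is_lim_const.
Qed.

(** Both [H - D] and [H + D] are nondecreasing and vanish at [-oo]. This stands in for comparing
    improper integrals from [-oo], and serves every Volterra estimate below. *)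
Lemma abs_le_of_derive (D H dD dH : R -> R) :
  (forall x, is_derive D x (dD x)) -> (forall x, is_derive H x (dH x)) ->
  (forall x, Rabs (dD x) <= dH x) ->
  is_lim D m_infty 0 -> is_lim H m_infty 0 -> forall x, Rabs (D x) <= H x.
Proof.
  intros HD HH Hle LD LH x.
  assert (A : 0 <= H x - D x).
  { apply (nonneg_of_lim_m_infty (fun x => H x - D x)).
    - apply (nondecreasing_of_derive _ (fun x => dH x - dD x)).
      + intro z. apply (is_derive_minus (K := R_AbsRing) (V := R_NormedModule) H D); auto.
      + intro z. specialize (Hle z). apply Rabs_le_between in Hle. lra.
    - replace (Finite 0) with (Finite (0 - 0)) by (f_equal; ring).
      now apply is_lim_minus'. }
  assert (B : 0 <= H x + D x).
  { apply (nonneg_of_lim_m_infty (fun x => H x + D x)).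
    - apply (nondecreasing_of_derive _ (fun x => dH x + dD x)).
      + intro z. apply (is_derive_plus (K := R_AbsRing) (V := R_NormedModule) H D); auto.
      + intro z. specialize (Hle z). apply Rabs_le_between in Hle. lra.
    - replace (Finite 0) with (Finite (0 + 0)) by (f_equal; ring).
      now apply is_lim_plus'. }
  apply Rabs_le. lra.
Qed.

Lemma lim_zero_of_abs_le (f g : R -> R) (x : Rbar) :
  (forall z, Rabs (f z) <= g z) -> is_lim g x 0 -> is_lim f x 0.
Proof.
  intros H Hg.
  apply (is_lim_le_le_loc (fun z => - g z) g f x 0).
  - apply filter_forall. intro z. specialize (H z). apply Rabs_le_between in H. lra.
  - replace (Finite 0) with (Rbar_opp 0) by (simpl; f_equal; ring). now apply is_lim_opp.
  - exact Hg.
Qed.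

Lemma ex_lim_p_infty_monotone (f : R -> R) (B : R) :
  (forall x y, x <= y -> f x <= f y) -> (forall x, f x <= B) ->
  exists L : R, is_lim f p_infty L.
Proof.
  intros Hi Hb.
  destruct (completeness (fun r => exists z, r = f z)) as [L [HL1 HL2]].
  - exists B. intros r [z ->]. apply Hb.
  - exists (f 0). now exists 0.
  - exists L. apply is_lim_spec. intros eps.
    assert (exists z, L - eps < f z) as [z Hz].
    { apply NNPP. intro HN.
      assert (L <= L - eps).
      { apply HL2. intros r [z ->]. apply Rnot_lt_le. intro. apply HN. now exists z. }
      destruct eps; simpl in *; lra. }
    exists z. intros x Hx.
    assert (f z <= f x) by (apply Hi; lra).
    assert (f x <= L) by (apply HL1; now exists x).
    apply Rabs_def1; destruct eps; simpl in *; lra.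
Qed.

(** [f] is the difference of the bounded nondecreasing functions [f + G] and [G]. *)
Lemma ex_lim_p_infty_dominated (f df G dG : R -> R) (B : R) :
  (forall x, is_derive f x (df x)) -> (forall x, is_derive G x (dG x)) ->
  (forall x, Rabs (df x) <= dG x) -> (forall x, Rabs (f x) <= B) -> (forall x, G x <= B) ->
  exists L : R, is_lim f p_infty L.
Proof.
  intros Hf HG Hle Hb HB.
  destruct (ex_lim_p_infty_monotone G B) as [L1 H1]; [| exact HB |].
  { apply (nondecreasing_of_derive _ dG HG). intro x. eapply Rle_trans; [apply Rabs_pos | apply Hle]. }
  destruct (ex_lim_p_infty_monotone (fun x => f x + G x) (B + B)) as [L2 H2].
  - apply (nondecreasing_of_derive _ (fun x => df x + dG x)).
    + intro z. apply (is_derive_plus (K := R_AbsRing) (V := R_NormedModule) f G); auto.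
    + intro z. specialize (Hle z). apply Rabs_le_between in Hle. lra.
  - intro x. specialize (Hb x). apply Rabs_le_between in Hb. specialize (HB x). lra.
  - exists (L2 - L1). apply (is_lim_ext (fun x => (f x + G x) - G x)).
    + intro; ring.
    + now apply is_lim_minus'.
Qed.

(** * Bounded solutions of linear first-order equations *)

Lemma is_derive_scale_exp (C y : R -> R) (c dy x : R) :
  is_derive C x c -> is_derive y x dy ->
  is_derive (fun t => y t * exp (C t)) x ((dy + c * y x) * exp (C x)).
Proof.
  intros HC Hy. auto_derive.
  - repeat split; eexists; eassumption.
  - rewrite (is_derive_unique (fun t : R => y t) x dy Hy), (is_derive_unique (fun t : R => C t) x c HC). ring.
Qed.

(** The constants [e] and [- e] are barriers. With the integrating factor [exp (I x)], where
    [I' = c], the source is dominated by the derivative of [e * exp (I x)], and the dominated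
    primitive is the solution wanted, whatever the behaviour of [I] at either end. *)
Lemma linear_ode_forward (c h : R -> R) (e : R) :
  (forall x, continuous c x) -> (forall x, continuous h x) -> 0 <= e ->
  (forall x, Rabs (h x) <= e * c x) ->
  exists y, (forall x, is_derive y x (- c x * y x + h x)) /\ (forall x, Rabs (y x) <= e).
Proof.
  intros Hc Hh He Hle.
  destruct (ex_primitive c Hc) as [I HI].
  assert (HcE : forall x, continuous (fun t => exp (I t)) x).
  { intro x. apply (continuous_of_derive _ x (c x * exp (I x))).
    auto_derive; [eexists; apply HI|].
    rewrite (is_derive_unique (fun t : R => I t) x (c x) (HI x)). ring. }
  destruct (dominated_primitive (fun x => h x * exp (I x)) (fun x => (0 + c x * e) * exp (I x))
              (fun x => e * exp (I x))) as [F [HF HFb]].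
  - intro x. apply (continuous_mult (K := R_AbsRing) h (fun t => exp (I t))); auto.
  - intro x. apply (is_derive_scale_exp I (fun _ => e)); auto.
    apply (is_derive_const (K := R_AbsRing) (V := R_NormedModule)).
  - intro x. apply Rmult_le_pos; [exact He | left; apply exp_pos].
  - intro x. rewrite Rabs_mult, (Rabs_pos_eq (exp (I x))) by (left; apply exp_pos).
    apply Rmult_le_compat_r; [left; apply exp_pos |]. specialize (Hle x). lra.
  - exists (fun x => F x * exp (- I x)). split.
    + intro x.
      assert (HE : exp (I x) * exp (- I x) = 1)
        by (rewrite <- exp_plus; replace (I x + - I x) with 0 by ring; apply exp_0).
      replace (- c x * (F x * exp (- I x)) + h x)
        with ((h x * exp (I x) + (- c x) * F x) * exp (- I x)).
      2:{ transitivity (h x * (exp (I x) * exp (- I x)) - c x * F x * exp (- I x)); [ring|].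
          rewrite HE. ring. }
      apply (is_derive_scale_exp (fun t => - I t) F); auto.
      apply (is_derive_opp (K := R_AbsRing) (V := R_NormedModule) I); auto.
    + intro x.
      assert (HE : exp (I x) * exp (- I x) = 1)
        by (rewrite <- exp_plus; replace (I x + - I x) with 0 by ring; apply exp_0).
      rewrite Rabs_mult, (Rabs_pos_eq (exp (- I x))) by (left; apply exp_pos).
      replace e with (e * exp (I x) * exp (- I x)) by (rewrite Rmult_assoc, HE; ring).
      apply Rmult_le_compat_r; [left; apply exp_pos | apply HFb].
Qed.

Lemma is_derive_reflect (f : R -> R) (x l : R) :
  is_derive f (- x) l -> is_derive (fun t => f (- t)) x (- l).
Proof.
  intro H. auto_derive.
  - eexists; eassumption.
  - rewrite (is_derive_unique (fun t : R => f t) (- x) l H). ring.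
Qed.

Lemma continuous_reflect (f : R -> R) :
  (forall x, continuous f x) -> forall x, continuous (fun t => f (- t)) x.
Proof.
  intros H x. apply (continuous_comp (fun t => - t) f); auto.
  apply (continuous_opp (K := R_AbsRing) (V := R_NormedModule) (fun t => t)), continuous_id.
Qed.

Lemma linear_ode_backward (c h : R -> R) (e : R) :
  (forall x, continuous c x) -> (forall x, continuous h x) -> 0 <= e ->
  (forall x, Rabs (h x) <= e * c x) ->
  exists y, (forall x, is_derive y x (c x * y x - h x)) /\ (forall x, Rabs (y x) <= e).
Proof.
  intros Hc Hh He Hle.
  destruct (linear_ode_forward (fun x => c (- x)) (fun x => h (- x)) e) as [y [Hy Hb]];
    auto using continuous_reflect.
  exists (fun x => y (- x)). split; [|auto].
  intro x. replace (c x * y (- x) - h x) with (- (- c (- - x) * y (- x) + h (- - x))).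
  - apply is_derive_reflect, Hy.
  - rewrite Ropp_involutive. ring.
Qed.

Lemma is_lim_exp_scal_m_infty (a : R) : 0 < a -> is_lim (fun x => exp (a * x)) m_infty 0.
Proof.
  intro Ha. apply is_lim_spec. intro eps.
  exists (ln eps / a). intros x Hx.
  rewrite Rminus_0_r, Rabs_pos_eq by (left; apply exp_pos).
  rewrite <- (exp_ln eps) by apply cond_pos.
  apply exp_increasing.
  apply (Rmult_lt_compat_l a) in Hx; [| exact Ha].
  replace (a * (ln eps / a)) with (ln eps) in Hx by (field; lra). exact Hx.
Qed.

(** Homogeneous solutions are multiples of [exp (- I x)], which blows up at [-oo] because [c >= a]
    there. The bound [B] excludes them, and its size does not enter the conclusion. Applied to
    differences of solutions, this gives uniqueness and Lipschitz dependence at once. *)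
Lemma linear_ode_forward_bound (c h y : R -> R) (e B a : R) :
  (forall x, continuous c x) -> 0 < a -> (forall x, x <= 0 -> a <= c x) ->
  (forall x, is_derive y x (- c x * y x + h x)) ->
  (forall x, Rabs (h x) <= e * c x) -> (forall x, Rabs (y x) <= B) ->
  forall x, Rabs (y x) <= e.
Proof.
  intros Hc Ha Hac Hy Hle HB x.
  destruct (ex_primitive c Hc) as [I HI].
  assert (He0 : is_lim (fun x => exp (I x)) m_infty 0).
  { apply (is_lim_le_le_loc (fun _ => 0) (fun x => exp (I 0) * exp (a * x))).
    - exists 0. intros z Hz. split; [left; apply exp_pos|].
      rewrite <- exp_plus.
      destruct (MVT_gen I z 0 c) as [s [Hs1 Hs2]].
      + intros; apply HI.
      + intros t _. apply continuity_pt_filterlim. eapply continuous_of_derive, HI.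
      + rewrite Rmin_left, Rmax_right in Hs1 by lra.
        assert (a * (0 - z) <= c s * (0 - z)) by (apply Rmult_le_compat_r; [lra | apply Hac; lra]).
        destruct (Req_dec (I z) (I 0 + a * z)) as [->|]; [lra|].
        left. apply exp_increasing. lra.
    - apply is_lim_const.
    - replace (Finite 0) with (Rbar_mult (exp (I 0)) 0) by (simpl; f_equal; ring).
      apply is_lim_scal_l. now apply is_lim_exp_scal_m_infty. }
  assert (Hs : forall K, is_lim (fun x => K * exp (I x)) m_infty 0).
  { intro K. replace (Finite 0) with (Rbar_mult K 0) by (simpl; f_equal; ring).
    now apply is_lim_scal_l. }
  assert (HH : forall x, Rabs (y x * exp (I x)) <= e * exp (I x)).
  { apply (abs_le_of_derive _ _ (fun x => ((- c x * y x + h x) + c x * y x) * exp (I x))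
             (fun x => (0 + c x * e) * exp (I x))).
    - intro z. apply (is_derive_scale_exp I y); auto.
    - intro z. apply (is_derive_scale_exp I (fun _ => e)); auto.
      apply (is_derive_const (K := R_AbsRing) (V := R_NormedModule)).
    - intro z. rewrite Rabs_mult, (Rabs_pos_eq (exp (I z))) by (left; apply exp_pos).
      apply Rmult_le_compat_r; [left; apply exp_pos|].
      replace (- c z * y z + h z + c z * y z) with (h z) by ring. specialize (Hle z). lra.
    - apply (lim_zero_of_abs_le _ (fun x => B * exp (I x))); [| apply Hs].
      intro z. rewrite Rabs_mult, (Rabs_pos_eq (exp (I z))) by (left; apply exp_pos).
      apply Rmult_le_compat_r; [left; apply exp_pos | apply HB].
    - apply Hs. }
  specialize (HH x). rewrite Rabs_mult, (Rabs_pos_eq (exp (I x))) in HH by (left; apply exp_pos).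
  apply Rmult_le_reg_r in HH; [exact HH | apply exp_pos].
Qed.

Lemma linear_ode_backward_bound (c h y : R -> R) (e B a : R) :
  (forall x, continuous c x) -> 0 < a -> (forall x, 0 <= x -> a <= c x) ->
  (forall x, is_derive y x (c x * y x - h x)) ->
  (forall x, Rabs (h x) <= e * c x) -> (forall x, Rabs (y x) <= B) ->
  forall x, Rabs (y x) <= e.
Proof.
  intros Hc Ha Hac Hy Hle HB x.
  rewrite <- (Ropp_involutive x).
  apply (linear_ode_forward_bound (fun x => c (- x)) (fun x => h (- x)) (fun x => y (- x)) e B a);
    auto using continuous_reflect.
  - intros z Hz. apply Hac. lra.
  - intro z. replace (- c (- z) * y (- z) + h (- z)) with (- (c (- z) * y (- z) - h (- z))) by ring.
    apply is_derive_reflect, Hy.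
Qed.

(** * A contraction principle in a weighted sup norm *)

(** [T] is a relation because a step is built from functions known only to exist; description
    chooses an orbit. The limit is pointwise, so the domain [A] is asked to be closed only along
    geometrically convergent sequences, and the fixed point is stated as pointwise equality of [F]
    and one of its successors. *)
Lemma weighted_fixed_point {I : Type} (W : I -> R) (A : (I -> R) -> Prop)
  (T : (I -> R) -> (I -> R) -> Prop) (N0 q : R) (F0 : I -> R) :
  (forall i, 0 <= W i) -> 0 <= N0 -> 0 <= q < 1 -> A F0 ->
  (forall F, A F -> exists F', A F' /\ T F F') ->
  (forall F G, A F -> A G -> forall i, Rabs (F i - G i) <= N0 * W i) ->
  (forall F G F' G' N, A F -> A G -> T F F' -> T G G' -> 0 <= N <= N0 ->
     (forall i, Rabs (F i - G i) <= N * W i) ->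
     forall i, Rabs (F' i - G' i) <= q * N * W i) ->
  (forall (Fn : nat -> I -> R) F, (forall n, A (Fn n)) ->
     (forall n i, Rabs (Fn n i - F i) <= N0 * q ^ n * W i) -> A F) ->
  exists F F', A F /\ T F F' /\ forall i, F i = F' i.
Proof.
  intros HW HN0 Hq HF0 Hex Hdiam Hcontr Hclosed.
  pose (step := fun X : {F | A F} =>
    let s := constructive_indefinite_description _ (Hex (proj1_sig X) (proj2_sig X)) in
    exist A (proj1_sig s) (proj1 (proj2_sig s))).
  assert (Hstep : forall X, T (proj1_sig X) (proj1_sig (step X))).
  { intro X. unfold step. simpl.
    destruct (constructive_indefinite_description _ _) as [G [HG1 HG2]]. exact HG2. }
  pose (X := fun n => nat_rect (fun _ => {F | A F}) (exist A F0 HF0) (fun _ Y => step Y) n).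
  pose (Fn := fun n => proj1_sig (X n)).
  assert (HA : forall n, A (Fn n)) by (intro n; apply (proj2_sig (X n))).
  assert (HT : forall n, T (Fn n) (Fn (S n))) by (intro n; apply (Hstep (X n))).
  assert (Hqn : forall n, 0 <= q ^ n <= 1).
  { intro n. split; [apply pow_le; lra|]. rewrite <- (pow1 n). apply pow_incr. lra. }
  (* Induction on [n] for all [k] at once: iterates [0] and [k] are within the diameter [N0], and
     each common step gains a factor [q]. No geometric series is summed. *)
  assert (Hc : forall n k i, Rabs (Fn n i - Fn (n + k)%nat i) <= N0 * q ^ n * W i).
  { induction n as [|n IH]; intros k i.
    - simpl. rewrite Rmult_1_r. apply Hdiam; apply HA.
    - replace (N0 * q ^ S n * W i) with (q * (N0 * q ^ n) * W i) by (simpl; ring).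
      apply (Hcontr (Fn n) (Fn (n + k)%nat)); auto.
      specialize (Hqn n). nra. }
  assert (Hlim : forall i, exists L : R, is_lim_seq (fun n => Fn n i) L).
  { intro i. apply ex_lim_seq_cauchy_corr. intro eps.
    assert (Hz : is_lim_seq (fun n => N0 * W i * q ^ n) 0).
    { replace (Finite 0) with (Rbar_mult (N0 * W i) 0) by (simpl; f_equal; ring).
      apply is_lim_seq_scal_l. apply is_lim_seq_geom. rewrite Rabs_pos_eq; lra. }
    apply is_lim_seq_spec in Hz. destruct (Hz (pos_div_2 eps)) as [M HM].
    exists M. intros n k Hn Hk.
    specialize (HM M (le_n M)). rewrite Rminus_0_r in HM.
    apply Rabs_def2 in HM. simpl in HM.
    assert (H1 := Hc M (n - M)%nat i). replace (M + (n - M))%nat with n in H1 by lia.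
    assert (H2 := Hc M (k - M)%nat i). replace (M + (k - M))%nat with k in H2 by lia.
    apply Rabs_le_between in H1. apply Rabs_le_between in H2.
    apply Rabs_def1; lra. }
  pose (F := fun i => proj1_sig (constructive_indefinite_description _ (Hlim i))).
  assert (HF : forall i, is_lim_seq (fun n => Fn n i) (F i)).
  { intro i. unfold F. apply (proj2_sig (constructive_indefinite_description _ (Hlim i))). }
  assert (Hb : forall n i, Rabs (Fn n i - F i) <= N0 * q ^ n * W i).
  { intros n i.
    assert (Hl : is_lim_seq (fun k => Fn n i - Fn (k + n)%nat i) (Fn n i - F i)).
    { apply is_lim_seq_minus'; [apply is_lim_seq_const|]. apply (is_lim_seq_incr_n (fun k => Fn k i)), HF. }
    apply Rabs_le. split.
    - apply (is_lim_seq_le (fun _ => - (N0 * q ^ n * W i)) (fun k => Fn n i - Fn (k + n)%nat i)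
               (- (N0 * q ^ n * W i)) (Fn n i - F i)); [| apply is_lim_seq_const | exact Hl].
      intro k. specialize (Hc n k i). rewrite Nat.add_comm in Hc. apply Rabs_le_between in Hc. lra.
    - apply (is_lim_seq_le (fun k => Fn n i - Fn (k + n)%nat i) (fun _ => N0 * q ^ n * W i)
               (Fn n i - F i) (N0 * q ^ n * W i)); [| exact Hl | apply is_lim_seq_const].
      intro k. specialize (Hc n k i). rewrite Nat.add_comm in Hc. apply Rabs_le_between in Hc. lra. }
  assert (HAF : A F) by (apply (Hclosed Fn F HA Hb)).
  destruct (Hex F HAF) as [F' [HAF' HTF]].
  exists F, F'. repeat split; auto.
  intro i.
  (* Contracting the pair [Fn n], [F] shows that [Fn (S n)] tends to [F']; it also tends to [F], so
     the two limits agree. *)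
  assert (H2 : is_lim_seq (fun n => Fn (S n) i - F' i) 0).
  { apply is_lim_seq_abs_0.
    apply (is_lim_seq_le_le (fun _ => 0) _ (fun n => q * N0 * W i * q ^ n)).
    - intro n. split; [apply Rabs_pos|].
      replace (q * N0 * W i * q ^ n) with (q * (N0 * q ^ n) * W i) by ring.
      apply (Hcontr (Fn n) F); auto. specialize (Hqn n). nra.
    - apply is_lim_seq_const.
    - replace (Finite 0) with (Rbar_mult (q * N0 * W i) 0) by (simpl; f_equal; ring).
      apply is_lim_seq_scal_l. apply is_lim_seq_geom. rewrite Rabs_pos_eq; lra. }
  assert (H3 : is_lim_seq (fun n => Fn (S n) i - F' i) (F i - F' i)).
  { apply is_lim_seq_minus'; [| apply is_lim_seq_const].
    apply (is_lim_seq_incr_1 (fun n => Fn n i)), HF. }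
  apply is_lim_seq_unique in H2. apply is_lim_seq_unique in H3.
  rewrite H2 in H3. injection H3. lra.
Qed.

(** * Logistic functions and the weight *)

(** The rate [1 / 4] makes [msig ^ 4] comparable to [ell] and [(1 - msig) ^ 4] comparable to
    [1 - ell]. Decay at both ends is then counted in integer powers, which can be spent one at a
    time. *)
Definition msig (x : R) : R := / (1 + exp (- x / 4)).
Definition ell (x : R) : R := / (1 + exp (- x)).
(** A Bielecki weight in the bounded variable [msig]: it decays like [ell] at [-oo], stays bounded
    at [+oo], and its logarithmic derivative is large in between. *)
Definition wt (x : R) : R := msig x ^ 4 * exp (3072 * msig x).
(** A majorant of the primitive of [wt] from [-oo]. As [wt] tends to a positive constant at [+oo],
    that primitive grows; the factor [1 / (1 - msig x) = 1 + exp (x / 4)] covers the growth crudely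
    and is later absorbed by the decay of [slope]. *)
Definition wtint (x : R) : R := msig x ^ 4 / (1 - msig x) * exp (3072 * msig x).
Definition wt_max : R := exp 3072.
(* The profile [p], when [V] is a primitive of [w - 2 ell]. *)
Definition slope (V : R -> R) (x : R) : R := 6 * ell x * (1 - ell x) * exp (- V x).

Lemma msig_bounds x : 0 < msig x < 1.
Proof.
  unfold msig. pose proof (exp_pos (- x / 4)). split.
  - apply Rinv_0_lt_compat. lra.
  - rewrite <- Rinv_1. apply Rinv_lt_contravar; lra.
Qed.

Lemma ell_bounds x : 0 < ell x < 1.
Proof.
  unfold ell. pose proof (exp_pos (- x)). split.
  - apply Rinv_0_lt_compat. lra.
  - rewrite <- Rinv_1. apply Rinv_lt_contravar; lra.
Qed.

Lemma msig_derive x : is_derive msig x (msig x * (1 - msig x) / 4).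
Proof.
  unfold msig. pose proof (exp_pos (- x / 4)). auto_derive; [lra|].
  change (- x * / 4) with (- x / 4). field. lra.
Qed.

Lemma ell_derive x : is_derive ell x (ell x * (1 - ell x)).
Proof.
  unfold ell. pose proof (exp_pos (- x)). auto_derive; [lra|]. field. lra.
Qed.

Lemma ell_continuous x : continuous ell x.
Proof. eapply continuous_of_derive, ell_derive. Qed.

Lemma exp_opp_pow4 x : exp (- x) = exp (- x / 4) ^ 4.
Proof. simpl. rewrite Rmult_1_r, <- !exp_plus. f_equal. field. Qed.

Lemma msig_pow4_le_ell x : msig x ^ 4 <= ell x.
Proof.
  unfold msig, ell. rewrite exp_opp_pow4. pose proof (exp_pos (- x / 4)) as Ht.
  set (t := exp (- x / 4)) in *. rewrite pow_inv.
  apply Rinv_le_contravar; [pose proof (pow_lt t 4 Ht); lra|].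
  assert (0 < t ^ 2) by now apply pow_lt. assert (0 < t ^ 3) by now apply pow_lt.
  replace ((1 + t) ^ 4) with (1 + t ^ 4 + (4 * t + 6 * t ^ 2 + 4 * t ^ 3)) by ring. lra.
Qed.

Lemma pow4_add_le t : 0 <= t -> (1 + t) ^ 4 <= 8 * (1 + t ^ 4).
Proof.
  intro Ht.
  assert ((1 + t) ^ 4 <= (2 * (1 + t ^ 2)) ^ 2).
  { replace ((1 + t) ^ 4) with (((1 + t) ^ 2) ^ 2) by ring. apply pow_incr.
    pose proof (pow2_ge_0 (1 - t)). split; [apply pow2_ge_0 | lra]. }
  pose proof (pow2_ge_0 (1 - t ^ 2)). lra.
Qed.

Lemma ell_le_msig_pow4 x : ell x <= 8 * msig x ^ 4.
Proof.
  unfold msig, ell. rewrite exp_opp_pow4. pose proof (exp_pos (- x / 4)) as Ht.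
  set (t := exp (- x / 4)) in *.
  assert (0 < t ^ 4) by now apply pow_lt. pose proof (pow4_add_le t ltac:(lra)).
  assert (0 < (1 + t) ^ 4) by (apply pow_lt; lra).
  apply (Rmult_le_reg_r ((1 + t ^ 4) * (1 + t) ^ 4)); [nra|].
  replace (/ (1 + t ^ 4) * ((1 + t ^ 4) * (1 + t) ^ 4)) with ((1 + t) ^ 4) by (field; lra).
  replace (8 * (/ (1 + t)) ^ 4 * ((1 + t ^ 4) * (1 + t) ^ 4)) with (8 * (1 + t ^ 4)) by (field; lra).
  lra.
Qed.

Lemma one_sub_ell_le x : 1 - ell x <= 8 * (1 - msig x) ^ 4.
Proof.
  unfold msig, ell. rewrite exp_opp_pow4. pose proof (exp_pos (- x / 4)) as Ht.
  set (t := exp (- x / 4)) in *.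
  assert (0 < t ^ 4) by now apply pow_lt. pose proof (pow4_add_le t ltac:(lra)).
  assert (0 < (1 + t) ^ 4) by (apply pow_lt; lra).
  apply (Rmult_le_reg_r ((1 + t ^ 4) * (1 + t) ^ 4)); [nra|].
  replace ((1 - / (1 + t ^ 4)) * ((1 + t ^ 4) * (1 + t) ^ 4)) with (t ^ 4 * (1 + t) ^ 4) by (field; lra).
  replace (8 * (1 - / (1 + t)) ^ 4 * ((1 + t ^ 4) * (1 + t) ^ 4)) with (t ^ 4 * (8 * (1 + t ^ 4))) by (field; lra).
  apply Rmult_le_compat_l; lra.
Qed.

Lemma msig_odds x : msig x / (1 - msig x) = exp (/ 4 * x).
Proof.
  unfold msig. pose proof (exp_pos (- x / 4)).
  assert (exp (/ 4 * x) * exp (- x / 4) = 1)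
    by (rewrite <- exp_plus; replace (/ 4 * x + - x / 4) with 0 by field; apply exp_0).
  apply (Rmult_eq_reg_r (exp (- x / 4))); [| lra]. rewrite H0. field. lra.
Qed.

Lemma msig_le_odds x : msig x <= exp (/ 4 * x).
Proof.
  rewrite <- msig_odds. pose proof (msig_bounds x).
  apply (Rmult_le_reg_r (1 - msig x)); [lra|].
  replace (msig x / (1 - msig x) * (1 - msig x)) with (msig x) by (field; lra). nra.
Qed.

Lemma is_lim_odds K : is_lim (fun x => K * exp (/ 4 * x)) m_infty 0.
Proof.
  replace (Finite 0) with (Rbar_mult K 0) by (simpl; f_equal; ring).
  apply is_lim_scal_l, is_lim_exp_scal_m_infty. lra.
Qed.

Lemma is_lim_msig_m_infty K : 0 <= K -> is_lim (fun x => K * msig x) m_infty 0.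
Proof.
  intro HK. apply (lim_zero_of_abs_le _ (fun x => K * exp (/ 4 * x))); [| apply is_lim_odds].
  intro x. pose proof (msig_bounds x).
  rewrite Rabs_pos_eq by (apply Rmult_le_pos; lra).
  apply Rmult_le_compat_l; [exact HK | apply msig_le_odds].
Qed.

Lemma msig_pow4_le x : msig x ^ 4 <= msig x.
Proof.
  pose proof (msig_bounds x). assert (msig x ^ 3 <= 1) by (rewrite <- (pow1 3); apply pow_incr; lra).
  replace (msig x ^ 4) with (msig x * msig x ^ 3) by ring. nra.
Qed.

Lemma msig_pow4_pos x : 0 < msig x ^ 4.
Proof. apply pow_lt, msig_bounds. Qed.

Lemma wt_max_ge1 : 1 <= wt_max.
Proof. unfold wt_max. rewrite <- exp_0. left. apply exp_increasing. lra. Qed.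

Lemma exp_msig_bounds x : 1 <= exp (3072 * msig x) <= wt_max.
Proof.
  pose proof (msig_bounds x). unfold wt_max. rewrite <- exp_0 at 1.
  split; left; apply exp_increasing; lra.
Qed.

Lemma wt_bounds x : msig x ^ 4 <= wt x <= wt_max * msig x ^ 4.
Proof.
  unfold wt. pose proof (exp_msig_bounds x). pose proof (msig_pow4_pos x). nra.
Qed.

Lemma wt_derive x : is_derive wt x
  ((msig x ^ 4 * (1 - msig x) + 768 * msig x ^ 5 * (1 - msig x)) * exp (3072 * msig x)).
Proof.
  unfold wt. auto_derive; [repeat split; eexists; apply msig_derive|].
  rewrite (is_derive_unique (fun t : R => msig t) x _ (msig_derive x)). field.
Qed.

Lemma wtint_derive x : is_derive wtint x
  ((msig x ^ 4 + / 4 * msig x ^ 5 / (1 - msig x) + 768 * msig x ^ 5) * exp (3072 * msig x)).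
Proof.
  unfold wtint. pose proof (msig_bounds x).
  auto_derive; [repeat split; first [lra | eexists; apply msig_derive]|].
  rewrite (is_derive_unique (fun t : R => msig t) x _ (msig_derive x)). field. lra.
Qed.

Lemma wtint_derive_ge x :
  wt x <= (msig x ^ 4 + / 4 * msig x ^ 5 / (1 - msig x) + 768 * msig x ^ 5) * exp (3072 * msig x).
Proof.
  unfold wt. apply Rmult_le_compat_r; [left; apply exp_pos|].
  pose proof (msig_bounds x).
  assert (0 < msig x ^ 5) by (apply pow_lt; lra).
  assert (0 < / 4 * msig x ^ 5 / (1 - msig x)) by (apply Rdiv_lt_0_compat; lra). lra.
Qed.

Lemma wtint_pos x : 0 < wtint x.
Proof.
  unfold wtint. pose proof (msig_bounds x).
  apply Rmult_lt_0_compat; [apply Rdiv_lt_0_compat; [apply msig_pow4_pos | lra] | apply exp_pos].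
Qed.

Lemma is_lim_wtint N : 0 <= N -> is_lim (fun x => N * wtint x) m_infty 0.
Proof.
  intro HN. apply (lim_zero_of_abs_le _ (fun x => (N * wt_max) * exp (/ 4 * x))); [| apply is_lim_odds].
  intro x. pose proof (wtint_pos x). rewrite Rabs_pos_eq by nra.
  rewrite Rmult_assoc. apply Rmult_le_compat_l; [exact HN|].
  rewrite <- msig_odds. unfold wtint.
  pose proof (msig_bounds x). pose proof (exp_msig_bounds x). pose proof (msig_pow4_le x).
  pose proof (msig_pow4_pos x).
  rewrite Rmult_comm. apply Rmult_le_compat; try lra.
  - apply Rlt_le, Rdiv_lt_0_compat; lra.
  - apply Rmult_le_compat_r; [left; apply Rinv_0_lt_compat |]; lra.
Qed.

Lemma log_msig_derive x : is_derive (fun x => - ln (1 - msig x)) x (msig x / 4).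
Proof.
  pose proof (msig_bounds x).
  auto_derive; [repeat split; first [lra | eexists; apply msig_derive]|].
  rewrite (is_derive_unique (fun t : R => msig t) x _ (msig_derive x)). field. lra.
Qed.

Lemma exp_log_msig x : exp (- ln (1 - msig x)) = / (1 - msig x).
Proof. pose proof (msig_bounds x). rewrite exp_Ropp, exp_ln; lra. Qed.

Lemma log_msig_nonneg x : 0 <= - ln (1 - msig x).
Proof.
  pose proof (msig_bounds x).
  assert (ln (1 - msig x) < ln 1) by (apply ln_increasing; lra). rewrite ln_1 in H0. lra.
Qed.

Lemma log_msig_le x : - ln (1 - msig x) <= exp (/ 4 * x).
Proof.
  pose proof (msig_bounds x).
  assert (Hx : 1 + - ln (1 - msig x) <= exp (- ln (1 - msig x))).
  { destruct (Req_dec (- ln (1 - msig x)) 0) as [->|Hn]; [rewrite exp_0; lra | left; now apply exp_ineq1]. }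
  rewrite exp_log_msig in Hx. rewrite <- msig_odds.
  replace (msig x / (1 - msig x)) with (/ (1 - msig x) - 1) by (field; lra). lra.
Qed.

Lemma is_lim_log_msig : is_lim (fun x => - ln (1 - msig x)) m_infty 0.
Proof.
  apply (lim_zero_of_abs_le _ (fun x => 1 * exp (/ 4 * x))); [| apply is_lim_odds].
  intro x. rewrite Rabs_pos_eq by apply log_msig_nonneg. pose proof (log_msig_le x). lra.
Qed.

Lemma is_lim_one_sub_msig K : 0 <= K -> is_lim (fun x => K * (1 - msig x)) p_infty 0.
Proof.
  intro HK.
  apply (is_lim_ext (fun x => K * msig (- x))).
  { intro x. f_equal. unfold msig. replace (- - x / 4) with (- (- x / 4)) by field.
    rewrite exp_Ropp. pose proof (exp_pos (- x / 4)). field. lra. }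
  apply (is_lim_comp (fun y => K * msig y) (fun x => - x) p_infty 0 m_infty).
  - now apply is_lim_msig_m_infty.
  - replace m_infty with (Rbar_opp p_infty) by reflexivity. apply is_lim_opp, is_lim_id.
  - exists 0. intros. discriminate.
Qed.

Lemma pow_unit_interval t n : 0 <= t <= 1 -> 0 <= t ^ n <= 1.
Proof.
  intro Ht. split; [apply pow_le; lra|]. rewrite <- (pow1 n). apply pow_incr. lra.
Qed.

(** * Admissible pairs and their primitives *)

(** A ball around the explicit wave for [kap = 0]. The relative scale [1600] is chosen against the
    bound [384] for [slope]: an error in [Th] then reaches [F] with the factor
    [384 / 1600 = 24 / 100]. *)
Record admissible (r : R) (w Th : R -> R) : Prop := {
  adm_w_continuous : forall x, continuous w x;
  adm_Th_continuous : forall x, continuous Th x;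
  adm_w : forall x, Rabs (w x - 2 * ell x) <= r * wt x;
  adm_Th : forall x, Rabs (Th x - 1 / 3) <= r / 1600 }.

(** The bounds double as normalizations: their right-hand sides vanish at [-oo], so [V], [C] and [F]
    are the primitives started there. Here [- ln (1 - msig x) = ln (1 + exp (x / 4))] has derivative
    [msig x / 4], and [1536 = 4 * 384] because [msig' = msig (1 - msig) / 4]. With [c1 + 1 = C] and
    [c2 + 1 = C - 2 F], [S] is half the increment of [c1 + c2]. *)
Record primitives (w Th V C F : R -> R) (S : R) : Prop := {
  prim_V : forall x, is_derive V x (w x - 2 * ell x);
  prim_V_bound : forall x, Rabs (V x) <= - ln (1 - msig x);
  prim_C : forall x, is_derive C x (slope V x);
  prim_C_bound : forall x, Rabs (C x) <= 1536 * msig x;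
  prim_F : forall x, is_derive F x (Th x * slope V x);
  prim_F_bound : forall x, Rabs (F x) <= 1536 * msig x;
  prim_S : is_lim (fun x => C x - F x) p_infty S }.

(** [2 * ell] is at least [2 * msig ^ 4], while the allowed deviation is at most a quarter of
    [msig ^ 4]. A weight decaying like [ell] thus keeps [w] positive with an explicit rate, which
    the equation of [y] relies on. *)
Lemma adm_w_bounds r w Th : 0 <= r -> 4 * wt_max * r <= 1 -> admissible r w Th ->
  forall x, msig x ^ 4 <= w x <= 3.
Proof.
  intros Hr HrE HA x.
  pose proof (adm_w _ _ _ HA x) as H. apply Rabs_le_between in H.
  pose proof (wt_bounds x). pose proof (msig_pow4_le_ell x). pose proof (ell_bounds x).
  pose proof (msig_pow4_pos x). pose proof (msig_pow4_le x). pose proof (msig_bounds x).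
  assert (r * wt x <= r * (wt_max * msig x ^ 4)) by (apply Rmult_le_compat_l; lra).
  assert (wt_max * r * msig x ^ 4 <= / 4 * msig x ^ 4) by (apply Rmult_le_compat_r; lra).
  lra.
Qed.

Lemma adm_Th_bounds r w Th : 0 <= r -> 4 * wt_max * r <= 1 -> admissible r w Th ->
  forall x, 1 / 4 <= Th x <= 1 / 2.
Proof.
  intros Hr HrE HA x.
  pose proof (adm_Th _ _ _ HA x) as H. apply Rabs_le_between in H.
  pose proof wt_max_ge1. assert (r <= 1) by nra. lra.
Qed.

Lemma slope_pos V x : 0 < slope V x.
Proof.
  unfold slope. pose proof (ell_bounds x).
  apply Rmult_lt_0_compat; [nra | apply exp_pos].
Qed.

Lemma base_slope_le x : 6 * ell x * (1 - ell x) <= 384 * msig x ^ 4 * (1 - msig x) ^ 4.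
Proof.
  pose proof (ell_bounds x). pose proof (ell_le_msig_pow4 x). pose proof (one_sub_ell_le x).
  replace (384 * msig x ^ 4 * (1 - msig x) ^ 4)
    with (6 * ((8 * msig x ^ 4) * (8 * (1 - msig x) ^ 4))) by ring.
  rewrite Rmult_assoc. apply Rmult_le_compat_l; [lra|]. apply Rmult_le_compat; lra.
Qed.

(** The possible growth of [exp (- V)] costs one of the four factors [1 - msig] of the base
    profile. *)
Lemma slope_le V x : Rabs (V x) <= - ln (1 - msig x) ->
  slope V x <= 384 * msig x ^ 4 * (1 - msig x) ^ 3.
Proof.
  intro H. pose proof (msig_bounds x).
  assert (exp (- V x) <= / (1 - msig x)).
  { rewrite <- exp_log_msig. apply Rabs_le_between in H.
    destruct (Req_dec (- V x) (- ln (1 - msig x))) as [->|]; [lra|].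
    left; apply exp_increasing; lra. }
  replace (384 * msig x ^ 4 * (1 - msig x) ^ 3)
    with (384 * msig x ^ 4 * (1 - msig x) ^ 4 * / (1 - msig x)) by (field; lra).
  unfold slope. pose proof (ell_bounds x).
  apply Rmult_le_compat; [nra | left; apply exp_pos | apply base_slope_le | assumption].
Qed.

Lemma slope_le_msig V x : Rabs (V x) <= - ln (1 - msig x) ->
  slope V x <= 384 * msig x ^ 4 /\ slope V x <= 384 * msig x * (1 - msig x).
Proof.
  intro H. pose proof (slope_le V x H). pose proof (msig_bounds x) as [H1 H2].
  set (m := msig x) in *.
  assert (0 < m ^ 4) by now apply pow_lt.
  assert (0 < (1 - m) ^ 3) by (apply pow_lt; lra).
  assert ((1 - m) ^ 3 <= 1) by (rewrite <- (pow1 3); apply pow_incr; lra).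
  assert ((1 - m) ^ 3 <= 1 - m).
  { replace ((1 - m) ^ 3) with ((1 - m) ^ 2 * (1 - m)) by ring.
    assert ((1 - m) ^ 2 <= 1) by (rewrite <- (pow1 2); apply pow_incr; lra). nra. }
  assert (m ^ 4 <= m) by apply msig_pow4_le.
  split; [nra|].
  eapply Rle_trans; [eassumption|]. rewrite !Rmult_assoc.
  apply Rmult_le_compat_l; [lra|]. apply Rmult_le_compat; lra.
Qed.

Lemma slope_derive V v x : is_derive V x v ->
  is_derive (slope V) x ((1 - 2 * ell x - v) * slope V x).
Proof.
  intro HV. unfold slope.
  auto_derive; [repeat split; first [eexists; eassumption | eexists; apply ell_derive]|].
  rewrite (is_derive_unique (fun t : R => ell t) x _ (ell_derive x)),
    (is_derive_unique (fun t : R => V t) x _ HV). ring.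
Qed.

Lemma prim_slope_derive w Th V C F S : primitives w Th V C F S ->
  forall x, is_derive (slope V) x ((1 - w x) * slope V x).
Proof.
  intros HP x. replace (1 - w x) with (1 - 2 * ell x - (w x - 2 * ell x)) by ring.
  apply slope_derive, (prim_V _ _ _ _ _ _ HP).
Qed.

Lemma msig_scal_derive K x : is_derive (fun x => K * msig x) x (K * (msig x * (1 - msig x) / 4)).
Proof. apply is_derive_scal, msig_derive. Qed.

Lemma primitives_exist r w Th : 0 <= r -> 4 * wt_max * r <= 1 -> admissible r w Th ->
  exists V C F S, primitives w Th V C F S.
Proof.
  intros Hr HrE HA.
  assert (Hc : forall x, continuous (fun x => w x - 2 * ell x) x).
  { intro x. apply (continuous_minus (V := R_NormedModule) w (fun x => 2 * ell x)).
    - apply (adm_w_continuous _ _ _ HA).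
    - apply (continuous_scal_r (K := R_AbsRing) (V := R_NormedModule) 2 ell), ell_continuous. }
  destruct (dominated_primitive (fun x => w x - 2 * ell x) (fun x => msig x / 4)
              (fun x => - ln (1 - msig x))) as [V [HV HVb]]; auto using log_msig_derive, log_msig_nonneg.
  { intro x. pose proof (adm_w _ _ _ HA x). pose proof (wt_bounds x).
    pose proof (msig_pow4_pos x). pose proof (msig_pow4_le x).
    assert (r * wt x <= r * (wt_max * msig x ^ 4)) by (apply Rmult_le_compat_l; lra).
    assert (wt_max * r * msig x ^ 4 <= / 4 * msig x ^ 4) by (apply Rmult_le_compat_r; lra). lra. }
  assert (Hpc : forall x, continuous (slope V) x).
  { intro x. eapply continuous_of_derive, slope_derive, HV. }
  assert (Hp : forall x, 0 < slope V x <= 1536 * (msig x * (1 - msig x) / 4)).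
  { intro x. split; [apply slope_pos|]. pose proof (proj2 (slope_le_msig V x (HVb x))). lra. }
  assert (HTh := adm_Th_bounds r w Th Hr HrE HA).
  assert (Hm0 : forall x, 0 <= 1536 * msig x) by (intro x; pose proof (msig_bounds x); lra).
  destruct (dominated_primitive (slope V) (fun x => 1536 * (msig x * (1 - msig x) / 4))
              (fun x => 1536 * msig x)) as [C [HC HCb]]; auto using msig_scal_derive.
  { intro x. specialize (Hp x). rewrite Rabs_pos_eq; lra. }
  destruct (dominated_primitive (fun x => Th x * slope V x)
              (fun x => 1536 * (msig x * (1 - msig x) / 4))
              (fun x => 1536 * msig x)) as [F [HF HFb]]; auto using msig_scal_derive.
  { intro x. apply (continuous_mult (K := R_AbsRing) Th (slope V)); auto.
    apply (adm_Th_continuous _ _ _ HA). }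
  { intro x. specialize (Hp x). specialize (HTh x). rewrite Rabs_pos_eq; nra. }
  destruct (ex_lim_p_infty_dominated (fun x => C x - F x)
    (fun x => slope V x - Th x * slope V x) (fun x => 1536 * msig x)
    (fun x => 1536 * (msig x * (1 - msig x) / 4)) 3072) as [S HS]; auto using msig_scal_derive.
  { intro x. apply (is_derive_minus (K := R_AbsRing) (V := R_NormedModule) C F); auto. }
  { intro x. specialize (Hp x). specialize (HTh x). rewrite Rabs_pos_eq; nra. }
  { intro x. specialize (HCb x). specialize (HFb x). pose proof (msig_bounds x).
    apply Rabs_le_between in HCb. apply Rabs_le_between in HFb. apply Rabs_le. lra. }
  { intro x. pose proof (msig_bounds x). lra. }
  exists V, C, F, S. constructor; auto.
Qed.

Lemma is_lim_ell_p_infty K : is_lim (fun x => K * ell x) p_infty K.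
Proof.
  apply (is_lim_ext (fun x => K - K * (1 - ell x))); [intro; ring|].
  replace (Finite K) with (Finite (K - K * 0)) by (f_equal; ring).
  apply is_lim_minus'; [apply is_lim_const|].
  apply (is_lim_scal_l _ K p_infty 0).
  apply (lim_zero_of_abs_le _ (fun x => 8 * (1 - msig x))); [| apply is_lim_one_sub_msig; lra].
  intro x. pose proof (ell_bounds x). pose proof (one_sub_ell_le x). pose proof (msig_bounds x).
  rewrite Rabs_pos_eq by lra.
  assert ((1 - msig x) ^ 3 <= 1) by (rewrite <- (pow1 3); apply pow_incr; lra).
  replace ((1 - msig x) ^ 4) with ((1 - msig x) ^ 3 * (1 - msig x)) in * by ring. nra.
Qed.

(** The explicit wave is the reference point: comparing with it turns the Lipschitz estimates below
    into a priori bounds. Its values [F = 2] at [+oo] and [S = 4] give the limits [2 / 4 = 1 / 2]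
    and [1 / 4] of the theorem. *)
Lemma primitives_base :
  primitives (fun x => 2 * ell x) (fun _ => 1 / 3) (fun _ => 0)
    (fun x => 6 * ell x) (fun x => 2 * ell x) 4.
Proof.
  assert (He : forall x, ell x <= 8 * msig x).
  { intro x. pose proof (ell_le_msig_pow4 x). pose proof (msig_pow4_le x). lra. }
  constructor; try (intro x; pose proof (ell_bounds x); pose proof (msig_bounds x); specialize (He x)).
  - replace (2 * ell x - 2 * ell x) with 0 by ring.
    apply (is_derive_const (K := R_AbsRing) (V := R_NormedModule)).
  - rewrite Rabs_R0. apply log_msig_nonneg.
  - replace (slope (fun _ => 0) x) with (6 * (ell x * (1 - ell x))).
    + apply is_derive_scal, ell_derive.
    + unfold slope. rewrite Ropp_0, exp_0. ring.
  - rewrite Rabs_pos_eq; lra.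
  - replace (1 / 3 * slope (fun _ => 0) x) with (2 * (ell x * (1 - ell x))).
    + apply is_derive_scal, ell_derive.
    + unfold slope. rewrite Ropp_0, exp_0. field.
  - rewrite Rabs_pos_eq; lra.
  - apply (is_lim_ext (fun x => 4 * ell x)); [intro; ring | apply is_lim_ell_p_infty].
Qed.

(** * Lipschitz dependence of the primitives on the pair *)

Definition wt_close (N : R) (w Th w' Th' : R -> R) : Prop :=
  (forall x, Rabs (w x - w' x) <= N * wt x) /\ (forall x, Rabs (Th x - Th' x) <= N / 1600).

Lemma exp_opp_lipschitz B a b : Rabs a <= B -> Rabs b <= B ->
  Rabs (exp (- a) - exp (- b)) <= exp B * Rabs (a - b).
Proof.
  intros Ha Hb. apply Rabs_le_between in Ha. apply Rabs_le_between in Hb.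
  assert (HD : forall x, is_derive (fun t => exp (- t)) x (- exp (- x)))
    by (intro x; auto_derive; [exact I | ring]).
  destruct (MVT_gen (fun t => exp (- t)) b a (fun t => - exp (- t))) as [c [Hc1 Hc2]].
  - intros; apply HD.
  - intros x _. apply continuity_pt_filterlim. apply (continuous_of_derive (fun t => exp (- t)) x _ (HD x)).
  - rewrite Hc2, Rabs_mult, Rabs_Ropp, Rabs_pos_eq by (left; apply exp_pos).
    apply Rmult_le_compat_r; [apply Rabs_pos|].
    assert (- B <= c) by (eapply Rle_trans; [apply (Rmin_glb b a (- B)); lra | apply Hc1]).
    destruct (Req_dec (- c) B) as [->|]; [lra | left; apply exp_increasing; lra].
Qed.

Lemma V_close N w Th V C F S w' Th' V' C' F' S' : 0 <= N ->
  primitives w Th V C F S -> primitives w' Th' V' C' F' S' -> wt_close N w Th w' Th' ->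
  forall x, Rabs (V x - V' x) <= N * wtint x.
Proof.
  intros HN HP HP' [Hw _].
  apply (abs_le_of_derive _ _ (fun x => (w x - 2 * ell x) - (w' x - 2 * ell x))
           (fun x => N * ((msig x ^ 4 + / 4 * msig x ^ 5 / (1 - msig x) + 768 * msig x ^ 5)
                          * exp (3072 * msig x)))).
  - intro x. apply (is_derive_minus (K := R_AbsRing) (V := R_NormedModule) V V').
    + apply (prim_V _ _ _ _ _ _ HP).
    + apply (prim_V _ _ _ _ _ _ HP').
  - intro x. apply is_derive_scal, wtint_derive.
  - intro x. replace (w x - 2 * ell x - (w' x - 2 * ell x)) with (w x - w' x) by ring.
    eapply Rle_trans; [apply Hw|]. apply Rmult_le_compat_l; [exact HN | apply wtint_derive_ge].
  - replace (Finite 0) with (Finite (0 - 0)) by (f_equal; ring).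
    apply is_lim_minus'; eapply lim_zero_of_abs_le; try apply is_lim_log_msig.
    + apply (prim_V_bound _ _ _ _ _ _ HP).
    + apply (prim_V_bound _ _ _ _ _ _ HP').
  - now apply is_lim_wtint.
Qed.

(** Count of powers: the base profile gives [msig ^ 4 * (1 - msig) ^ 4], the Lipschitz constant of
    the exponential costs one factor [1 - msig], and [wtint] costs another one while contributing a
    second [msig ^ 4]. *)
Lemma slope_close N w Th V C F S w' Th' V' C' F' S' : 0 <= N ->
  primitives w Th V C F S -> primitives w' Th' V' C' F' S' -> wt_close N w Th w' Th' ->
  forall x, Rabs (slope V x - slope V' x)
    <= N * 384 * msig x ^ 8 * (1 - msig x) ^ 2 * exp (3072 * msig x).
Proof.
  intros HN HP HP' Hcl x.
  pose proof (V_close _ _ _ _ _ _ _ _ _ _ _ _ _ HN HP HP' Hcl x) as HV.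
  unfold slope.
  rewrite <- Rmult_minus_distr_l, Rabs_mult.
  pose proof (ell_bounds x). pose proof (msig_bounds x). pose proof (base_slope_le x).
  rewrite (Rabs_pos_eq (6 * ell x * (1 - ell x))) by nra.
  pose proof (exp_opp_lipschitz _ _ _ (prim_V_bound _ _ _ _ _ _ HP x) (prim_V_bound _ _ _ _ _ _ HP' x)) as HL.
  rewrite exp_log_msig in HL.
  replace (N * 384 * msig x ^ 8 * (1 - msig x) ^ 2 * exp (3072 * msig x))
    with ((384 * msig x ^ 4 * (1 - msig x) ^ 4) * (/ (1 - msig x) * (N * wtint x)))
    by (unfold wtint; field; lra).
  apply Rmult_le_compat; [nra | apply Rabs_pos | assumption |].
  eapply Rle_trans; [exact HL|]. apply Rmult_le_compat_l; [left; apply Rinv_0_lt_compat; lra | exact HV].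
Qed.

Lemma slope_close_wt N w Th V C F S w' Th' V' C' F' S' : 0 <= N ->
  primitives w Th V C F S -> primitives w' Th' V' C' F' S' -> wt_close N w Th w' Th' ->
  forall x, Rabs (slope V x - slope V' x) <= 384 * N * wt x.
Proof.
  intros HN HP HP' Hcl x.
  eapply Rle_trans; [eapply slope_close; eassumption|].
  pose proof (msig_bounds x). unfold wt. pose proof (exp_pos (3072 * msig x)).
  set (e := exp (3072 * msig x)) in *. pose proof (msig_pow4_pos x).
  assert (msig x ^ 4 * (1 - msig x) ^ 2 <= 1).
  { pose proof (pow_unit_interval (msig x) 4 ltac:(lra)).
    pose proof (pow_unit_interval (1 - msig x) 2 ltac:(lra)). nra. }
  replace (N * 384 * msig x ^ 8 * (1 - msig x) ^ 2 * e)
    with (384 * N * (msig x ^ 4 * e) * (msig x ^ 4 * (1 - msig x) ^ 2)) by ring.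
  rewrite <- (Rmult_1_r (384 * N * (msig x ^ 4 * e))) at 2.
  apply Rmult_le_compat_l; [|assumption].
  apply Rmult_le_pos; [lra|]. apply Rmult_le_pos; lra.
Qed.

Lemma C_close N w Th V C F S w' Th' V' C' F' S' : 0 <= N ->
  primitives w Th V C F S -> primitives w' Th' V' C' F' S' -> wt_close N w Th w' Th' ->
  forall x, Rabs (C x - C' x) <= 1536 * wt_max * N * msig x.
Proof.
  intros HN HP HP' Hcl.
  pose proof wt_max_ge1.
  apply (abs_le_of_derive _ _ (fun x => slope V x - slope V' x)
           (fun x => 1536 * wt_max * N * (msig x * (1 - msig x) / 4))).
  - intro x. apply (is_derive_minus (K := R_AbsRing) (V := R_NormedModule) C C').
    + apply (prim_C _ _ _ _ _ _ HP).
    + apply (prim_C _ _ _ _ _ _ HP').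
  - intro x. apply msig_scal_derive.
  - intro x. eapply Rle_trans; [eapply slope_close; eassumption|].
    pose proof (msig_bounds x). pose proof (exp_msig_bounds x).
    replace (1536 * wt_max * N * (msig x * (1 - msig x) / 4))
      with (N * 384 * (msig x * (1 - msig x)) * wt_max) by field.
    replace (N * 384 * msig x ^ 8 * (1 - msig x) ^ 2)
      with (N * 384 * (msig x * (1 - msig x)) * (msig x ^ 7 * (1 - msig x) ^ 1)) by ring.
    assert (0 <= msig x * (1 - msig x)) by nra.
    assert (0 <= msig x ^ 7 * (1 - msig x) ^ 1 <= 1).
    { pose proof (pow_unit_interval (msig x) 7 ltac:(lra)).
      pose proof (pow_unit_interval (1 - msig x) 1 ltac:(lra)). nra. }
    assert (0 <= N * 384 * (msig x * (1 - msig x))) by (apply Rmult_le_pos; lra).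
    apply Rmult_le_compat; try lra; [apply Rmult_le_pos; lra |].
    rewrite <- (Rmult_1_r (N * 384 * (msig x * (1 - msig x)))) at 2.
    apply Rmult_le_compat_l; lra.
  - replace (Finite 0) with (Finite (0 - 0)) by (f_equal; ring).
    apply is_lim_minus'; eapply lim_zero_of_abs_le; try (apply (is_lim_msig_m_infty 1536); lra).
    + apply (prim_C_bound _ _ _ _ _ _ HP).
    + apply (prim_C_bound _ _ _ _ _ _ HP').
  - apply is_lim_msig_m_infty. apply Rmult_le_pos; lra.
Qed.

(* The exponent [3072] in the weight is what brings the factor of the
   [w]-part down to [1/4]. *)
Lemma F_close N w Th V C F S w' Th' V' C' F' S' : 0 <= N ->
  (forall x, 1 / 4 <= Th' x <= 1 / 2) ->
  primitives w Th V C F S -> primitives w' Th' V' C' F' S' -> wt_close N w Th w' Th' ->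
  forall x, Rabs (F x - F' x) <= N * (49 / 100) * wt x.
Proof.
  intros HN HTh HP HP' Hcl.
  assert (HH : forall x, Rabs (F x - F' x) <= N * (24 / 100 * msig x ^ 4 + 25 / 100 * wt x)).
  { apply (abs_le_of_derive _ _ (fun x => Th x * slope V x - Th' x * slope V' x)
      (fun x => N * (24 / 100 * (msig x ^ 4 * (1 - msig x)) + 25 / 100 *
        ((msig x ^ 4 * (1 - msig x) + 768 * msig x ^ 5 * (1 - msig x)) * exp (3072 * msig x))))).
  - intro x. apply (is_derive_minus (K := R_AbsRing) (V := R_NormedModule) F F').
    + apply (prim_F _ _ _ _ _ _ HP).
    + apply (prim_F _ _ _ _ _ _ HP').
  - intro x. apply is_derive_scal.
    apply (is_derive_plus (K := R_AbsRing) (V := R_NormedModule)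
      (fun x => 24 / 100 * msig x ^ 4) (fun x => 25 / 100 * wt x)).
    + apply is_derive_scal. auto_derive; [repeat split; eexists; apply msig_derive|].
      rewrite (is_derive_unique (fun t : R => msig t) x _ (msig_derive x)). field.
    + apply is_derive_scal, wt_derive.
  - intro x.
    pose proof (slope_close _ _ _ _ _ _ _ _ _ _ _ _ _ HN HP HP' Hcl x) as Hp.
    destruct Hcl as [_ HT]. specialize (HT x). specialize (HTh x).
    pose proof (slope_le V x (prim_V_bound _ _ _ _ _ _ HP x)). pose proof (slope_pos V x).
    pose proof (msig_bounds x) as [Hm1 Hm2]. pose proof (exp_pos (3072 * msig x)) as He.
    set (e := exp (3072 * msig x)) in *. set (m := msig x) in *.
    replace (Th x * slope V x - Th' x * slope V' x)
      with ((Th x - Th' x) * slope V x + Th' x * (slope V x - slope V' x)) by ring.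
    eapply Rle_trans; [apply Rabs_triang|]. rewrite !Rabs_mult.
    rewrite (Rabs_pos_eq (slope V x)), (Rabs_pos_eq (Th' x)) by lra.
    assert (A1 : Rabs (Th x - Th' x) * slope V x <= N / 1600 * (384 * m ^ 4 * (1 - m) ^ 3))
      by (apply Rmult_le_compat; try lra; apply Rabs_pos).
    assert (A2 : Th' x * Rabs (slope V x - slope V' x)
      <= 1 / 2 * (N * 384 * m ^ 8 * (1 - m) ^ 2 * e))
      by (apply Rmult_le_compat; try lra; apply Rabs_pos).
    assert (0 < m ^ 4) by now apply pow_lt. assert (0 < m ^ 5) by now apply pow_lt.
    assert (A3 : m ^ 4 * (1 - m) ^ 3 <= m ^ 4 * (1 - m)).
    { apply Rmult_le_compat_l; [lra|]. replace ((1 - m) ^ 3) with ((1 - m) ^ 2 * (1 - m)) by ring.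
      assert ((1 - m) ^ 2 <= 1) by (rewrite <- (pow1 2); apply pow_incr; lra). nra. }
    assert (A4 : m ^ 8 * (1 - m) ^ 2 * e <= m ^ 5 * (1 - m) * e).
    { apply Rmult_le_compat_r; [lra|].
      replace (m ^ 8 * (1 - m) ^ 2) with ((m ^ 5 * (1 - m)) * (m ^ 3 * (1 - m))) by ring.
      assert (m ^ 3 <= 1) by (rewrite <- (pow1 3); apply pow_incr; lra).
      assert (0 < m ^ 3) by now apply pow_lt.
      assert (0 < m ^ 5 * (1 - m)) by nra. assert (m ^ 3 * (1 - m) <= 1) by nra. nra. }
    assert (0 <= m ^ 4 * (1 - m) * e) by (apply Rmult_le_pos; nra).
    apply (Rmult_le_compat_l N) in A3; [| exact HN].
    apply (Rmult_le_compat_l N) in A4; [| exact HN].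
    assert (0 <= N * (m ^ 4 * (1 - m) * e)) by (apply Rmult_le_pos; lra).
    replace ((m ^ 4 * (1 - m) + 768 * m ^ 5 * (1 - m)) * e)
      with (m ^ 4 * (1 - m) * e + 768 * (m ^ 5 * (1 - m) * e)) by ring.
    nra.
  - replace (Finite 0) with (Finite (0 - 0)) by (f_equal; ring).
    apply is_lim_minus'; eapply lim_zero_of_abs_le; try (apply (is_lim_msig_m_infty 1536); lra).
    + apply (prim_F_bound _ _ _ _ _ _ HP).
    + apply (prim_F_bound _ _ _ _ _ _ HP').
  - pose proof wt_max_ge1.
    apply (lim_zero_of_abs_le _ (fun x => (N * wt_max) * msig x)).
    + intro x. pose proof (wt_bounds x). pose proof (msig_pow4_pos x). pose proof (msig_pow4_le x).
      rewrite Rabs_pos_eq by (apply Rmult_le_pos; lra).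
      rewrite Rmult_assoc. apply Rmult_le_compat_l; [lra|]. nra.
    + apply is_lim_msig_m_infty. apply Rmult_le_pos; lra. }
  intro x. eapply Rle_trans; [apply HH|]. rewrite Rmult_assoc.
  apply Rmult_le_compat_l; [exact HN|]. pose proof (wt_bounds x). lra.
Qed.

Lemma lim_close (f g : R -> R) (a b K : R) :
  is_lim f p_infty a -> is_lim g p_infty b -> (forall x, Rabs (f x - g x) <= K) ->
  Rabs (a - b) <= K.
Proof.
  intros Hf Hg HK.
  assert (H : is_lim (fun x => f x - g x) p_infty (a - b)) by now apply is_lim_minus'.
  apply Rabs_le. split.
  - apply (is_lim_le_loc (fun _ => - K) (fun x => f x - g x) p_infty (- K) (a - b)); [| apply is_lim_const | exact H].
    exists 0. intros x _. specialize (HK x). apply Rabs_le_between in HK. lra.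
  - apply (is_lim_le_loc (fun x => f x - g x) (fun _ => K) p_infty (a - b) K); [| exact H | apply is_lim_const].
    exists 0. intros x _. specialize (HK x). apply Rabs_le_between in HK. lra.
Qed.

Lemma S_close N w Th V C F S w' Th' V' C' F' S' : 0 <= N ->
  (forall x, 1 / 4 <= Th' x <= 1 / 2) ->
  primitives w Th V C F S -> primitives w' Th' V' C' F' S' -> wt_close N w Th w' Th' ->
  Rabs (S - S') <= 1537 * wt_max * N.
Proof.
  intros HN HTh HP HP' Hcl.
  apply (lim_close (fun x => C x - F x) (fun x => C' x - F' x)).
  - apply (prim_S _ _ _ _ _ _ HP).
  - apply (prim_S _ _ _ _ _ _ HP').
  - intro x.
    pose proof (C_close _ _ _ _ _ _ _ _ _ _ _ _ _ HN HP HP' Hcl x) as H1.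
    pose proof (F_close _ _ _ _ _ _ _ _ _ _ _ _ _ HN HTh HP HP' Hcl x) as H2.
    replace (C x - F x - (C' x - F' x)) with ((C x - C' x) + - (F x - F' x)) by ring.
    eapply Rle_trans; [apply Rabs_triang|]. rewrite Rabs_Ropp.
    pose proof (msig_bounds x). pose proof (wt_bounds x). pose proof (msig_pow4_le x). pose proof wt_max_ge1.
    assert (0 <= wt_max * N) by (apply Rmult_le_pos; lra).
    assert (1536 * wt_max * N * msig x <= 1536 * (wt_max * N)) by nra.
    assert (wt x <= wt_max) by nra.
    assert (N * wt x <= wt_max * N) by nra. lra.
Qed.

(** * The relaxation equations and the corrected unknown [y] *)

Lemma continuous_Rplus (f g : R -> R) (x : R) :
  continuous f x -> continuous g x -> continuous (fun t => f t + g t) x.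
Proof. apply (continuous_plus (K := R_AbsRing) (V := R_NormedModule)). Qed.

Lemma continuous_Rminus (f g : R -> R) (x : R) :
  continuous f x -> continuous g x -> continuous (fun t => f t - g t) x.
Proof. apply (continuous_minus (K := R_AbsRing) (V := R_NormedModule)). Qed.

Lemma continuous_Rmult (f g : R -> R) (x : R) :
  continuous f x -> continuous g x -> continuous (fun t => f t * g t) x.
Proof. apply (continuous_mult (K := R_AbsRing)). Qed.

Lemma continuous_Rconst (a x : R) : continuous (fun _ : R => a) x.
Proof. apply continuous_const. Qed.

Ltac cts := lazymatch goal with
  | |- continuous (fun _ => ?a) _ => apply continuous_Rconst
  | |- continuous (fun t => @?f t - @?g t) _ => apply (continuous_Rminus f g); cts
  | |- continuous (fun t => @?f t + @?g t) _ => apply (continuous_Rplus f g); cts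
  | |- continuous (fun t => @?f t * @?g t) _ => apply (continuous_Rmult f g); cts
  | H : forall x, continuous ?f x |- continuous ?f _ => apply H
  | H : forall x, continuous ?f x |- continuous (fun t => ?f t) _ => apply H
  end.

Definition theta (al be : R -> R) (x : R) : R := (al x + be x) / 2.
(** The equations below give [kap (al p)' = (Th - al) p] and [kap (be p)' = (be - Th) p], hence
    [(defect p)' = (Th - theta) p]. Subtracting [defect p] from [F] therefore changes the derivative
    from [Th p] to [theta p]. *)
Definition defect (kap : R) (al be : R -> R) (x : R) : R := kap * (al x - be x) / 2.
Definition source (w V al be : R -> R) (x : R) : R :=
  2 * w x + 4 * w x ^ 2 - 4 * (slope V x * theta al be x).

(** The bounds act as boundary conditions at infinity: for admissible [w] and small [kap] each
    equation has only one bounded solution, determined from [-oo] for [al] and from [+oo] for [be]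
    and [y]. *)
Record relaxed (kap : R) (w Th V al be y : R -> R) : Prop := {
  al_derive : forall x,
    is_derive al x (- ((1 + kap * (1 - w x)) * / kap) * al x + Th x * / kap);
  al_bound : forall x, 0 <= al x <= 1;
  be_derive : forall x,
    is_derive be x ((1 - kap * (1 - w x)) * / kap * be x - Th x * / kap);
  be_bound : forall x, 0 <= be x <= 1;
  y_derive : forall x,
    is_derive y x (3 * w x * y x - defect kap al be x * source w V al be x);
  y_bound : forall x, Rabs (y x) <= 300 * kap }.

Lemma theta_bounds kap w Th V al be y : relaxed kap w Th V al be y ->
  forall x, 0 <= theta al be x <= 1.
Proof.
  intros HR x. unfold theta.
  pose proof (al_bound _ _ _ _ _ _ _ HR x). pose proof (be_bound _ _ _ _ _ _ _ HR x). lra.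
Qed.

Lemma defect_bound kap al be x : 0 <= kap -> 0 <= al x <= 1 -> 0 <= be x <= 1 ->
  Rabs (defect kap al be x) <= kap / 2.
Proof. intros. unfold defect. apply Rabs_le. nra. Qed.

(** Every term carries a factor [w], since [slope <= 384 * msig ^ 4 <= 384 * w]; the constant is
    [2 + 4 * 3 + 4 * 384]. With [defect] at most [kap / 2] and the coefficient [3 * w], this is what
    makes the bound [300 * kap] for [y] hold up to [-oo]. *)
Lemma source_bound (w V al be : R -> R) x :
  msig x ^ 4 <= w x <= 3 -> Rabs (V x) <= - ln (1 - msig x) ->
  0 <= al x <= 1 -> 0 <= be x <= 1 ->
  Rabs (source w V al be x) <= 1550 * w x.
Proof.
  intros Hw HV Ha Hb.
  pose proof (slope_pos V x). pose proof (proj1 (slope_le_msig V x HV)).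
  pose proof (msig_pow4_pos x).
  assert (0 <= slope V x * theta al be x <= 384 * w x) by (unfold theta; nra).
  unfold source. apply Rabs_le. nra.
Qed.

Lemma relaxed_exists kap r w Th V C F S : 0 <= r -> 4 * wt_max * r <= 1 -> 0 < kap <= 1 / 4 ->
  admissible r w Th -> primitives w Th V C F S -> exists al be y, relaxed kap w Th V al be y.
Proof.
  intros Hr HrE Hk HA HP.
  pose proof (adm_w_bounds r w Th Hr HrE HA) as Hw.
  pose proof (adm_Th_bounds r w Th Hr HrE HA) as HT.
  pose proof (adm_w_continuous _ _ _ HA) as Hcw. pose proof (adm_Th_continuous _ _ _ HA) as HcT.
  assert (Hik : 0 < / kap) by (apply Rinv_0_lt_compat; lra).
  assert (Hw0 : forall x, 0 <= w x <= 3).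
  { intro x. specialize (Hw x). pose proof (msig_pow4_pos x). lra. }
  (* Shifting by [1 / 2] encodes [0 <= al <= 1] as a symmetric bound. The requirement on the source
     becomes [0 <= Th <= c] with [c = 1 + kap (1 - w)], which holds because [Th <= 1 / 2 <= c]. *)
  destruct (linear_ode_forward (fun x => (1 + kap * (1 - w x)) * / kap)
    (fun x => (Th x - 1 / 2 * (1 + kap * (1 - w x))) * / kap) (1 / 2)) as [a [Ha Hab]].
  { intro x. cts. } { intro x. cts. } { lra. }
  { intro x. rewrite Rabs_mult, (Rabs_pos_eq (/ kap)), <- Rmult_assoc by lra.
    apply Rmult_le_compat_r; [lra|]. specialize (Hw0 x). specialize (HT x).
    assert (1 / 2 <= 1 + kap * (1 - w x)) by nra. apply Rabs_le. lra. }
  destruct (linear_ode_backward (fun x => (1 - kap * (1 - w x)) * / kap)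
    (fun x => (Th x - 1 / 2 * (1 - kap * (1 - w x))) * / kap) (1 / 2)) as [b [Hb Hbb]].
  { intro x. cts. } { intro x. cts. } { lra. }
  { intro x. rewrite Rabs_mult, (Rabs_pos_eq (/ kap)), <- Rmult_assoc by lra.
    apply Rmult_le_compat_r; [lra|]. specialize (Hw0 x). specialize (HT x).
    assert (1 / 2 <= 1 - kap * (1 - w x)) by nra. apply Rabs_le. lra. }
  set (al := fun x => a x + 1 / 2). set (be := fun x => b x + 1 / 2).
  assert (Hal : forall x, is_derive al x (- ((1 + kap * (1 - w x)) * / kap) * al x + Th x * / kap)).
  { intro x. unfold al.
    replace (- ((1 + kap * (1 - w x)) * / kap) * (a x + 1 / 2) + Th x * / kap)
      with ((- ((1 + kap * (1 - w x)) * / kap) * a x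
             + (Th x - 1 / 2 * (1 + kap * (1 - w x))) * / kap) + 0) by ring.
    apply (is_derive_plus (K := R_AbsRing) (V := R_NormedModule) a (fun _ => 1 / 2)); auto.
    apply (is_derive_const (K := R_AbsRing) (V := R_NormedModule)). }
  assert (Hbe : forall x, is_derive be x ((1 - kap * (1 - w x)) * / kap * be x - Th x * / kap)).
  { intro x. unfold be.
    replace ((1 - kap * (1 - w x)) * / kap * (b x + 1 / 2) - Th x * / kap)
      with (((1 - kap * (1 - w x)) * / kap * b x
             - (Th x - 1 / 2 * (1 - kap * (1 - w x))) * / kap) + 0) by ring.
    apply (is_derive_plus (K := R_AbsRing) (V := R_NormedModule) b (fun _ => 1 / 2)); auto.
    apply (is_derive_const (K := R_AbsRing) (V := R_NormedModule)). }
  assert (Halb : forall x, 0 <= al x <= 1).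
  { intro x. unfold al. specialize (Hab x). apply Rabs_le_between in Hab. lra. }
  assert (Hbeb : forall x, 0 <= be x <= 1).
  { intro x. unfold be. specialize (Hbb x). apply Rabs_le_between in Hbb. lra. }
  assert (Hca : forall x, continuous al x) by (intro x; eapply continuous_of_derive, Hal).
  assert (Hcb : forall x, continuous be x) by (intro x; eapply continuous_of_derive, Hbe).
  assert (Hcp : forall x, continuous (slope V) x)
    by (intro x; eapply continuous_of_derive, (prim_slope_derive _ _ _ _ _ _ HP)).
  destruct (linear_ode_backward (fun x => 3 * w x)
    (fun x => defect kap al be x * source w V al be x) (300 * kap)) as [y [Hy Hyb]].
  { intro x. cts. }
  { intro x. unfold defect, source, theta, Rdiv. simpl pow. cts. }
  { lra. }
  { intro x. rewrite Rabs_mult.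
    pose proof (defect_bound kap al be x ltac:(lra) (Halb x) (Hbeb x)) as H1.
    pose proof (source_bound w V al be x (Hw x) (prim_V_bound _ _ _ _ _ _ HP x) (Halb x) (Hbeb x)) as H2.
    replace (300 * kap * (3 * w x)) with (kap / 2 * (1800 * w x)) by field.
    specialize (Hw0 x).
    apply Rmult_le_compat; try apply Rabs_pos; lra. }
  exists al, be, y. constructor; auto.
Qed.

(** * Lipschitz dependence of the relaxation variables *)

(** Passing from the weighted to the plain sup norm costs [wt_max], and the perturbative terms of a
    step carry [k] with at most one such factor; [10 ^ 12] leaves room for the explicit
    constants. *)
Definition small (k : R) : Prop := 0 < k /\ wt_max * k <= 1 / 10 ^ 12.

Lemma msig_ge_half x : 0 <= x -> 1 / 2 <= msig x.
Proof.
  intro Hx. unfold msig.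
  assert (exp (- x / 4) <= 1).
  { rewrite <- exp_0. destruct (Req_dec (- x / 4) 0) as [->|]; [lra | left; apply exp_increasing; lra]. }
  pose proof (exp_pos (- x / 4)).
  replace (1 / 2) with (/ 2) by field. apply Rinv_le_contravar; lra.
Qed.

Lemma kap_bounds k S : 0 < k -> 3 <= S -> 0 < k / S <= k / 3.
Proof.
  intros Hk HS. split; [apply Rdiv_lt_0_compat; lra|].
  unfold Rdiv. apply Rmult_le_compat_l; [lra|]. apply Rinv_le_contravar; lra.
Qed.

Lemma kap_ratio k S S' M : 0 < k -> 3 <= S -> 3 <= S' -> Rabs (S - S') <= 1537 * M ->
  Rabs (1 - k / S / (k / S')) <= 513 * M.
Proof.
  intros Hk HS HS' H.
  replace (1 - k / S / (k / S')) with ((S - S') * / S) by (field; lra).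
  rewrite Rabs_mult, (Rabs_pos_eq (/ S)) by (left; apply Rinv_0_lt_compat; lra).
  assert (/ S <= / 3) by (apply Rinv_le_contravar; lra).
  assert (0 < / S) by (apply Rinv_0_lt_compat; lra).
  pose proof (Rabs_pos (S - S')).
  assert (Rabs (S - S') * / S <= Rabs (S - S') * / 3) by (apply Rmult_le_compat_l; lra). lra.
Qed.

Lemma kap_diff kap kap' M : 0 < kap' -> Rabs (1 - kap / kap') <= M ->
  Rabs (kap - kap') <= M * kap'.
Proof.
  intros Hk H. replace (kap - kap') with (- (1 - kap / kap') * kap') by (field; lra).
  rewrite Rabs_mult, Rabs_Ropp, (Rabs_pos_eq kap') by lra.
  apply Rmult_le_compat_r; lra.
Qed.

(* [c = 1 + kap (1 - w)] for the forward equation and [c = 1 - kap (1 - w)]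
   for the backward one. *)
Lemma relaxation_source_bound M kap kap' c c' T T' a :
  0 <= M -> 0 <= kap' <= 1 / 1000 -> Rabs (1 - kap / kap') <= 513 * M ->
  Rabs (T - T') <= M -> 0 <= T' <= 1 / 2 -> 0 <= c' <= 2 -> 0 <= a <= 1 ->
  Rabs (c - c') <= 2 * M ->
  Rabs ((T - T') - a * (c - c') + (T' - a * c') * (1 - kap / kap')) <= 1300 * M.
Proof.
  intros HM Hk Hr HT HT' Hc' Ha Hc.
  eapply Rle_trans; [apply Rabs_triang|].
  eapply Rle_trans; [apply Rplus_le_compat_r; apply Rabs_triang|].
  rewrite Rabs_Ropp, !Rabs_mult, (Rabs_pos_eq a) by lra.
  assert (H1 : Rabs (T' - a * c') <= 2) by (apply Rabs_le; nra).
  assert (H2 : Rabs (T' - a * c') * Rabs (1 - kap / kap') <= 2 * (513 * M))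
    by (apply Rmult_le_compat; auto using Rabs_pos).
  assert (H3 : a * Rabs (c - c') <= 1 * (2 * M))
    by (apply Rmult_le_compat; try lra; apply Rabs_pos).
  lra.
Qed.

Lemma speed_diff_bound M kap kap' w w' :
  0 <= M -> 0 <= kap' <= 1 / 1000 -> Rabs (kap - kap') <= 513 * M * kap' ->
  0 <= w <= 3 -> Rabs (w - w') <= M ->
  Rabs (kap * (1 - w) - kap' * (1 - w')) <= 2 * M.
Proof.
  intros HM Hk Hkk Hw Hww.
  replace (kap * (1 - w) - kap' * (1 - w'))
    with ((kap - kap') * (1 - w) + - (kap' * (w - w'))) by ring.
  eapply Rle_trans; [apply Rabs_triang|].
  rewrite Rabs_Ropp, !Rabs_mult, (Rabs_pos_eq kap') by lra.
  assert (Rabs (1 - w) <= 2) by (apply Rabs_le; lra).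
  assert (Rabs (kap - kap') * Rabs (1 - w) <= 513 * M * kap' * 2)
    by (apply Rmult_le_compat; auto using Rabs_pos).
  assert (kap' * Rabs (w - w') <= 1 / 1000 * M)
    by (apply Rmult_le_compat; try lra; apply Rabs_pos).
  assert (M * kap' <= M * (1 / 1000)) by (apply Rmult_le_compat_l; lra).
  lra.
Qed.

(** Writing [1 / kap'] as [(kap / kap') / kap] puts one factor [1 / kap] before the whole source,
    where it cancels against the rate [c / kap]. Only the relative change of [kap] enters, so the
    constant does not degenerate as [kap] tends to [0]; it is [2 * 1300] because [c >= 1 / 2]. *)
Lemma relaxation_close r N kap kap' w Th V al be y w' Th' V' al' be' y' :
  0 <= r -> 4 * wt_max * r <= 1 -> 0 <= N ->
  0 < kap <= 1 / 1000 -> 0 < kap' <= 1 / 1000 ->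
  Rabs (1 - kap / kap') <= 513 * (wt_max * N) ->
  admissible r w Th -> admissible r w' Th' -> wt_close N w Th w' Th' ->
  relaxed kap w Th V al be y -> relaxed kap' w' Th' V' al' be' y' ->
  (forall x, Rabs (al x - al' x) <= 2600 * (wt_max * N)) /\
  (forall x, Rabs (be x - be' x) <= 2600 * (wt_max * N)).
Proof.
  intros Hr HrE HN Hk Hk' Hkk HA HA' [Hcw HcT] HR HR'.
  pose proof (adm_w_bounds r w Th Hr HrE HA) as Hw.
  pose proof (adm_w_bounds r w' Th' Hr HrE HA') as Hw'.
  pose proof (adm_Th_bounds r w' Th' Hr HrE HA') as HT'.
  pose proof wt_max_ge1.
  set (M := wt_max * N) in *.
  assert (HNM : N <= M) by (unfold M; nra).
  assert (HM : 0 <= M) by lra.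
  assert (Hd : Rabs (kap - kap') <= 513 * M * kap') by (apply kap_diff; lra).
  assert (Hwd : forall x, Rabs (w x - w' x) <= M).
  { intro x. eapply Rle_trans; [apply Hcw|]. unfold M.
    pose proof (wt_bounds x). pose proof (msig_pow4_le x). pose proof (msig_bounds x).
    assert (wt x <= wt_max) by nra. nra. }
  assert (HTd : forall x, Rabs (Th x - Th' x) <= M).
  { intro x. specialize (HcT x). lra. }
  assert (Hw0 : forall x, 0 <= w x <= 3).
  { intro x. specialize (Hw x). pose proof (msig_pow4_pos x). lra. }
  assert (Hw0' : forall x, 0 <= w' x <= 3).
  { intro x. specialize (Hw' x). pose proof (msig_pow4_pos x). lra. }
  pose proof (adm_w_continuous _ _ _ HA) as Hcont.
  assert (Hik : 0 < / kap) by (apply Rinv_0_lt_compat; lra).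
  split.
  - apply (linear_ode_forward_bound (fun x => (1 + kap * (1 - w x)) * / kap)
      (fun x => ((Th x - Th' x) - al' x * ((1 + kap * (1 - w x)) - (1 + kap' * (1 - w' x)))
        + (Th' x - al' x * (1 + kap' * (1 - w' x))) * (1 - kap / kap')) * / kap)
      (fun x => al x - al' x) (2600 * M) 1 (1 / 2 * / kap)).
    + intro x. cts.
    + lra.
    + intros x _. apply Rmult_le_compat_r; [lra|]. specialize (Hw0 x). nra.
    + intro x.
      match goal with |- is_derive _ _ ?t => replace t with
        ((- ((1 + kap * (1 - w x)) * / kap) * al x + Th x * / kap)
         - (- ((1 + kap' * (1 - w' x)) * / kap') * al' x + Th' x * / kap')) by (field; lra) end.
      apply (is_derive_minus (K := R_AbsRing) (V := R_NormedModule) al al').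
      * apply (al_derive _ _ _ _ _ _ _ HR).
      * apply (al_derive _ _ _ _ _ _ _ HR').
    + intro x. rewrite Rabs_mult, (Rabs_pos_eq (/ kap)), <- Rmult_assoc by lra.
      apply Rmult_le_compat_r; [lra|].
      specialize (Hw0 x). specialize (Hw0' x). specialize (HT' x).
      eapply Rle_trans.
      * apply (relaxation_source_bound M); auto; try lra; try nra.
        -- apply (al_bound _ _ _ _ _ _ _ HR').
        -- replace (1 + kap * (1 - w x) - (1 + kap' * (1 - w' x)))
             with (kap * (1 - w x) - kap' * (1 - w' x)) by ring.
           apply speed_diff_bound; auto; lra.
      * assert (1 / 2 <= 1 + kap * (1 - w x)) by nra. nra.
    + intro x. pose proof (al_bound _ _ _ _ _ _ _ HR x). pose proof (al_bound _ _ _ _ _ _ _ HR' x).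
      apply Rabs_le. lra.
  - apply (linear_ode_backward_bound (fun x => (1 - kap * (1 - w x)) * / kap)
      (fun x => ((Th x - Th' x) - be' x * ((1 - kap * (1 - w x)) - (1 - kap' * (1 - w' x)))
        + (Th' x - be' x * (1 - kap' * (1 - w' x))) * (1 - kap / kap')) * / kap)
      (fun x => be x - be' x) (2600 * M) 1 (1 / 2 * / kap)).
    + intro x. cts.
    + lra.
    + intros x _. apply Rmult_le_compat_r; [lra|]. specialize (Hw0 x). nra.
    + intro x.
      match goal with |- is_derive _ _ ?t => replace t with
        (((1 - kap * (1 - w x)) * / kap * be x - Th x * / kap)
         - ((1 - kap' * (1 - w' x)) * / kap' * be' x - Th' x * / kap')) by (field; lra) end.
      apply (is_derive_minus (K := R_AbsRing) (V := R_NormedModule) be be').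
      * apply (be_derive _ _ _ _ _ _ _ HR).
      * apply (be_derive _ _ _ _ _ _ _ HR').
    + intro x. rewrite Rabs_mult, (Rabs_pos_eq (/ kap)), <- Rmult_assoc by lra.
      apply Rmult_le_compat_r; [lra|].
      specialize (Hw0 x). specialize (Hw0' x). specialize (HT' x).
      eapply Rle_trans.
      * apply (relaxation_source_bound M); auto; try lra; try nra.
        -- apply (be_bound _ _ _ _ _ _ _ HR').
        -- replace (1 - kap * (1 - w x) - (1 - kap' * (1 - w' x)))
             with (- (kap * (1 - w x) - kap' * (1 - w' x))) by ring.
           rewrite Rabs_Ropp. apply speed_diff_bound; auto; lra.
      * assert (1 / 2 <= 1 - kap * (1 - w x)) by nra. nra.
    + intro x. pose proof (be_bound _ _ _ _ _ _ _ HR x). pose proof (be_bound _ _ _ _ _ _ _ HR' x).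
      apply Rabs_le. lra.
Qed.

Lemma Rabs_mult_sub_le a b a' b' A B dA dB :
  Rabs b <= B -> Rabs a' <= A -> Rabs (a - a') <= dA -> Rabs (b - b') <= dB ->
  Rabs (a * b - a' * b') <= dA * B + A * dB.
Proof.
  intros. replace (a * b - a' * b') with ((a - a') * b + a' * (b - b')) by ring.
  eapply Rle_trans; [apply Rabs_triang|]. rewrite !Rabs_mult.
  apply Rplus_le_compat; apply Rmult_le_compat; auto using Rabs_pos.
Qed.

Lemma defect_close k kap kap' M al be al' be' x :
  0 <= M -> 0 < kap <= k / 3 -> 0 < kap' <= k / 3 -> Rabs (1 - kap / kap') <= 513 * M ->
  0 <= al' x <= 1 -> 0 <= be' x <= 1 ->
  Rabs (al x - al' x) <= 2600 * M -> Rabs (be x - be' x) <= 2600 * M ->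
  Rabs (defect kap al be x - defect kap' al' be' x) <= 1000 * (k * M).
Proof.
  intros HM Hk Hk' Hkk Ha Hb Hda Hdb. unfold defect.
  assert (Hd : Rabs (kap - kap') <= 513 * M * kap') by (apply kap_diff; lra).
  replace (kap * (al x - be x) / 2 - kap' * (al' x - be' x) / 2)
    with ((kap - kap') * ((al' x - be' x) / 2)
          + kap * (((al x - al' x) - (be x - be' x)) / 2)) by field.
  eapply Rle_trans; [apply Rabs_triang|]. rewrite !Rabs_mult, (Rabs_pos_eq kap) by lra.
  assert (H1 : Rabs ((al' x - be' x) / 2) <= 1 / 2) by (apply Rabs_le; lra).
  assert (H2 : Rabs (((al x - al' x) - (be x - be' x)) / 2) <= 2600 * M).
  { apply Rabs_le_between in Hda. apply Rabs_le_between in Hdb. apply Rabs_le. lra. }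
  assert (Rabs (kap - kap') * Rabs ((al' x - be' x) / 2) <= 513 * M * kap' * (1 / 2))
    by (apply Rmult_le_compat; auto using Rabs_pos).
  assert (kap * Rabs (((al x - al' x) - (be x - be' x)) / 2) <= k / 3 * (2600 * M))
    by (apply Rmult_le_compat; try lra; apply Rabs_pos).
  assert (M * kap' <= M * (k / 3)) by (apply Rmult_le_compat_l; lra).
  assert (0 <= k * M) by (apply Rmult_le_pos; lra). lra.
Qed.

Lemma source_close M w V al be w' V' al' be' x :
  0 <= M -> 0 <= w x <= 3 -> 0 <= w' x <= 3 ->
  0 <= theta al be x <= 1 -> 0 <= slope V' x <= 384 * msig x ^ 4 ->
  Rabs (w x - w' x) <= M * msig x ^ 4 ->
  Rabs (slope V x - slope V' x) <= 384 * (M * msig x ^ 4) ->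
  Rabs (al x - al' x) <= 2600 * M -> Rabs (be x - be' x) <= 2600 * M ->
  Rabs (source w V al be x - source w' V' al' be' x) <= 5 * 10 ^ 6 * (M * msig x ^ 4).
Proof.
  intros HM Hw Hw' Ht Hp Hdw Hdp Hda Hdb. unfold source.
  assert (Hdt : Rabs (theta al be x - theta al' be' x) <= 2600 * M).
  { unfold theta. apply Rabs_le_between in Hda. apply Rabs_le_between in Hdb. apply Rabs_le. lra. }
  assert (HA : Rabs (slope V x * theta al be x - slope V' x * theta al' be' x)
     <= 384 * (M * msig x ^ 4) * 1 + 384 * msig x ^ 4 * (2600 * M)).
  { apply Rabs_mult_sub_le; auto; rewrite Rabs_pos_eq; lra. }
  assert (HB : Rabs (w x * w x - w' x * w' x) <= M * msig x ^ 4 * 3 + 3 * (M * msig x ^ 4)).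
  { apply Rabs_mult_sub_le; auto; rewrite Rabs_pos_eq; lra. }
  pose proof (msig_pow4_pos x). assert (0 <= M * msig x ^ 4) by nra.
  apply Rabs_le_between in HA. apply Rabs_le_between in HB. apply Rabs_le_between in Hdw.
  apply Rabs_le. simpl pow in *. lra.
Qed.

(** The gain of a factor [k] is the point: [al] and [be] are merely Lipschitz, but [y] sees them
    only through [defect], and the change of its coefficient [3 w] is multiplied by [y'], itself
    [O(k)]. All sources are again [O(w)]. *)
Lemma response_close r N k kap kap' w Th V C F S al be y w' Th' V' C' F' S' al' be' y' :
  0 <= r -> 4 * wt_max * r <= 1 -> 0 <= N -> small k ->
  0 < kap <= k / 3 -> 0 < kap' <= k / 3 ->
  Rabs (1 - kap / kap') <= 513 * (wt_max * N) ->
  admissible r w Th -> admissible r w' Th' -> wt_close N w Th w' Th' ->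
  primitives w Th V C F S -> primitives w' Th' V' C' F' S' ->
  relaxed kap w Th V al be y -> relaxed kap' w' Th' V' al' be' y' ->
  (forall x, Rabs (defect kap al be x - defect kap' al' be' x) <= 1000 * (k * (wt_max * N))) /\
  (forall x, Rabs (y x - y' x) <= 10 ^ 6 * (k * (wt_max * N))).
Proof.
  intros Hr HrE HN [Hk0 HkE] Hk Hk' Hkk HA HA' Hcl HP HP' HR HR'.
  pose proof wt_max_ge1 as HE.
  assert (Hk1 : k <= 1 / 1000) by nra.
  destruct (relaxation_close r N kap kap' w Th V al be y w' Th' V' al' be' y') as [Hda Hdb];
    auto; try lra.
  pose proof (adm_w_bounds r w Th Hr HrE HA) as Hw.
  pose proof (adm_w_bounds r w' Th' Hr HrE HA') as Hw'.
  pose proof (slope_close_wt _ _ _ _ _ _ _ _ _ _ _ _ _ HN HP HP' Hcl) as Hdp.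
  destruct Hcl as [Hcw HcT].
  pose proof (al_bound _ _ _ _ _ _ _ HR) as Ha. pose proof (be_bound _ _ _ _ _ _ _ HR) as Hb.
  pose proof (al_bound _ _ _ _ _ _ _ HR') as Ha'. pose proof (be_bound _ _ _ _ _ _ _ HR') as Hb'.
  set (M := wt_max * N) in *. assert (HM : 0 <= M) by (unfold M; nra).
  assert (Hdm : forall x, Rabs (defect kap al be x - defect kap' al' be' x) <= 1000 * (k * M)).
  { intro x. apply defect_close; auto. }
  split; [exact Hdm|].
  assert (Hw0 : forall x, 0 <= w x <= 3).
  { intro x. specialize (Hw x). pose proof (msig_pow4_pos x). lra. }
  assert (Hw0' : forall x, 0 <= w' x <= 3).
  { intro x. specialize (Hw' x). pose proof (msig_pow4_pos x). lra. }
  assert (Hwt : forall x, N * wt x <= M * msig x ^ 4).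
  { intro x. unfold M. pose proof (wt_bounds x). rewrite (Rmult_comm wt_max), Rmult_assoc.
    apply Rmult_le_compat_l; lra. }
  pose proof (adm_w_continuous _ _ _ HA) as Hcont.
  apply (linear_ode_backward_bound (fun x => 3 * w x)
    (fun x => (defect kap al be x * source w V al be x
               - defect kap' al' be' x * source w' V' al' be' x) - 3 * (y' x * (w x - w' x)))
    (fun x => y x - y' x) (10 ^ 6 * (k * M)) (600 * k) (3 / 16)).
  - intro x. cts.
  - lra.
  (* On the right half-line [w >= msig ^ 4 >= (1 / 2) ^ 4], whence the rate [3 / 16]. *)
  - intros x Hx. specialize (Hw x). pose proof (msig_ge_half x Hx).
    assert ((1 / 2) ^ 4 <= msig x ^ 4) by (apply pow_incr; lra). lra.
  - intro x.
    match goal with |- is_derive _ _ ?t => replace t with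
      ((3 * w x * y x - defect kap al be x * source w V al be x)
       - (3 * w' x * y' x - defect kap' al' be' x * source w' V' al' be' x)) by ring end.
    apply (is_derive_minus (K := R_AbsRing) (V := R_NormedModule) y y').
    + apply (y_derive _ _ _ _ _ _ _ HR).
    + apply (y_derive _ _ _ _ _ _ _ HR').
  - intro x. specialize (Hcw x). specialize (Hwt x). specialize (Hdp x).
    pose proof (proj1 (slope_le_msig V' x (prim_V_bound _ _ _ _ _ _ HP' x))).
    pose proof (slope_pos V' x).
    assert (H1 : Rabs (defect kap al be x * source w V al be x
               - defect kap' al' be' x * source w' V' al' be' x)
      <= 1000 * (k * M) * (1550 * w x) + k / 6 * (5 * 10 ^ 6 * (M * msig x ^ 4))).
    { apply Rabs_mult_sub_le.
      - apply source_bound; auto. apply (prim_V_bound _ _ _ _ _ _ HP).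
      - eapply Rle_trans; [apply defect_bound; auto|]; lra.
      - apply Hdm.
      - apply source_close; auto; try lra.
        apply (theta_bounds _ _ _ _ _ _ _ HR). }
    assert (H2 : Rabs (y' x * (w x - w' x)) <= 100 * k * (M * msig x ^ 4)).
    { rewrite Rabs_mult. apply Rmult_le_compat; auto using Rabs_pos; [|lra].
      eapply Rle_trans; [apply (y_bound _ _ _ _ _ _ _ HR')|]. lra. }
    eapply Rle_trans; [apply Rabs_triang|]. rewrite Rabs_Ropp, Rabs_mult, (Rabs_pos_eq 3) by lra.
    specialize (Hw x). pose proof (msig_pow4_pos x).
    assert (0 <= k * M) by (apply Rmult_le_pos; lra).
    assert (H5 : k * M * msig x ^ 4 <= k * M * w x) by (apply Rmult_le_compat_l; lra).
    assert (0 <= k * M * msig x ^ 4) by (apply Rmult_le_pos; lra).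
    simpl pow in *. lra.
  - intro x. pose proof (y_bound _ _ _ _ _ _ _ HR x) as H1. pose proof (y_bound _ _ _ _ _ _ _ HR' x) as H2.
    apply Rabs_le_between in H1. apply Rabs_le_between in H2. apply Rabs_le. lra.
Qed.

(** * The iteration step and its fixed point *)

Lemma is_lim_seq_geom_scal B q : 0 <= q < 1 -> is_lim_seq (fun n => B * q ^ n) 0.
Proof.
  intro Hq. replace (Finite 0) with (Rbar_mult B 0) by (simpl; f_equal; ring).
  apply is_lim_seq_scal_l. apply is_lim_seq_geom. rewrite Rabs_pos_eq; lra.
Qed.

Lemma continuous_geometric_limit (fn : nat -> R -> R) (f : R -> R) (B q : R) : 0 <= q < 1 ->
  (forall n x, continuous (fn n) x) -> (forall n x, Rabs (fn n x - f x) <= B * q ^ n) ->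
  forall x, continuous f x.
Proof.
  intros Hq Hc Hb x.
  apply continuity_pt_filterlim. intros eps Heps.
  pose proof (is_lim_seq_geom_scal B q Hq) as Hl. apply is_lim_seq_spec in Hl.
  destruct (Hl (mkposreal (eps / 3) ltac:(lra))) as [n Hn]. specialize (Hn n (le_n n)).
  simpl in Hn. rewrite Rminus_0_r in Hn. apply Rabs_def2 in Hn.
  pose proof (Hc n x) as H. apply continuity_pt_filterlim in H.
  destruct (H (eps / 3) ltac:(lra)) as [d [Hd1 Hd2]].
  exists d. split; [exact Hd1|]. intros t Ht. specialize (Hd2 t Ht).
  simpl in *. unfold Rdist in *.
  pose proof (Hb n x) as H1. pose proof (Hb n t) as H2.
  apply Rabs_le_between in H1. apply Rabs_le_between in H2. apply Rabs_def2 in Hd2.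
  apply Rabs_def1; lra.
Qed.

Lemma le_geometric_limit (a b B q : R) : 0 <= q < 1 -> (forall n, a <= b + B * q ^ n) -> a <= b.
Proof.
  intros Hq H.
  apply (is_lim_seq_le (fun _ => a) (fun n => b + B * q ^ n) a b H).
  - apply is_lim_seq_const.
  - replace (Finite b) with (Finite (b + 0)) by (f_equal; ring).
    apply is_lim_seq_plus'; [apply is_lim_seq_const | now apply is_lim_seq_geom_scal].
Qed.

(** All auxiliary functions belong to the old pair. The formula for [Thn] is
    [y = 2 (Th - 1 / 3 + w defect)] solved for [Th], so that it becomes the definition of [y] at a
    fixed point. *)
Definition is_step (k : R) (w Th wn Thn V C F : R -> R) (S : R) (al be y : R -> R) : Prop :=
  primitives w Th V C F S /\ 3 <= S <= 5 /\ relaxed (k / S) w Th V al be y /\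
  (forall x, wn x = F x - defect (k / S) al be x * slope V x) /\
  (forall x, Thn x = 1 / 3 + y x / 2 - w x * defect (k / S) al be x).

Lemma small_radius k : small k ->
  0 <= 2 * 10 ^ 5 * k /\ 4 * wt_max * (2 * 10 ^ 5 * k) <= 1 /\ 1537 * wt_max * (2 * 10 ^ 5 * k) <= 1 /\ k <= 1 / 1000.
Proof. intros [Hk HkE]. pose proof wt_max_ge1. simpl pow in *. repeat split; nra. Qed.

Lemma wt_close_base r w Th : admissible r w Th ->
  wt_close r w Th (fun x => 2 * ell x) (fun _ => 1 / 3).
Proof. intro HA. split; [apply (adm_w _ _ _ HA) | apply (adm_Th _ _ _ HA)]. Qed.

Lemma S_near_four k w Th V C F S : small k -> admissible (2 * 10 ^ 5 * k) w Th ->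
  primitives w Th V C F S -> 3 <= S <= 5.
Proof.
  intros Hk HA HP. destruct (small_radius k Hk) as [H1 [H2 [H3 H4]]].
  assert (H : Rabs (S - 4) <= 1537 * wt_max * (2 * 10 ^ 5 * k)).
  { apply (S_close _ w Th V C F S
      (fun x => 2 * ell x) (fun _ => 1 / 3) (fun _ => 0) (fun x => 6 * ell x) (fun x => 2 * ell x) 4 H1); [| exact HP | apply primitives_base | now apply wt_close_base].
    intro; lra. }
  apply Rabs_le_between in H. lra.
Qed.

(** The radius [r = 2 * 10 ^ 5 * k] makes the ball invariant. For [w] the error is at most
    [49 / 100 * r + 64 * k] times [wt]; for [Th] it is at most [50 * k] from [y / 2] and [k / 2]
    from [w defect], against [r / 1600 = 125 * k]. *)
Lemma step_exists k w Th : small k -> admissible (2 * 10 ^ 5 * k) w Th ->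
  exists wn Thn V C F S al be y,
    admissible (2 * 10 ^ 5 * k) wn Thn /\ is_step k w Th wn Thn V C F S al be y.
Proof.
  intros Hk HA. destruct (small_radius k Hk) as [H1 [H2 [H3 H4]]].
  set (r := 2 * 10 ^ 5 * k) in *.
  destruct (primitives_exist r w Th H1 H2 HA) as [V [C [F [S HP]]]].
  assert (HS := S_near_four k w Th V C F S Hk HA HP).
  assert (Hkap := kap_bounds k S (proj1 Hk) (proj1 HS)).
  destruct (relaxed_exists (k / S) r w Th V C F S H1 H2 ltac:(lra) HA HP) as [al [be [y HR]]].
  exists (fun x => F x - defect (k / S) al be x * slope V x),
    (fun x => 1 / 3 + y x / 2 - w x * defect (k / S) al be x), V, C, F, S, al, be, y.
  split; [| exact (conj HP (conj HS (conj HR (conj (fun _ => eq_refl) (fun _ => eq_refl)))))].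
  pose proof (adm_w_continuous _ _ _ HA) as Hcw.
  assert (Hca : forall x, continuous al x)
    by (intro x; eapply continuous_of_derive, (al_derive _ _ _ _ _ _ _ HR)).
  assert (Hcb : forall x, continuous be x)
    by (intro x; eapply continuous_of_derive, (be_derive _ _ _ _ _ _ _ HR)).
  assert (Hcy : forall x, continuous y x)
    by (intro x; eapply continuous_of_derive, (y_derive _ _ _ _ _ _ _ HR)).
  assert (HcF : forall x, continuous F x)
    by (intro x; eapply continuous_of_derive, (prim_F _ _ _ _ _ _ HP)).
  assert (Hcp : forall x, continuous (slope V) x)
    by (intro x; eapply continuous_of_derive, (prim_slope_derive _ _ _ _ _ _ HP)).
  assert (Hmu : forall x, Rabs (defect (k / S) al be x) <= k / 6).
  { intro x. eapply Rle_trans.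
    - apply defect_bound; [lra | apply (al_bound _ _ _ _ _ _ _ HR) | apply (be_bound _ _ _ _ _ _ _ HR)].
    - lra. }
  constructor.
  - intro x. unfold defect, Rdiv. cts.
  - intro x. unfold defect, Rdiv. cts.
  - intro x.
    assert (HF : Rabs (F x - 2 * ell x) <= r * (49 / 100) * wt x).
    { apply (F_close r w Th V C F S
        (fun x => 2 * ell x) (fun _ => 1 / 3) (fun _ => 0) (fun x => 6 * ell x) (fun x => 2 * ell x) 4 H1); [| exact HP | apply primitives_base | now apply wt_close_base].
      intro; lra. }
    pose proof (proj1 (slope_le_msig V x (prim_V_bound _ _ _ _ _ _ HP x))).
    pose proof (slope_pos V x). pose proof (wt_bounds x).
    assert (Rabs (defect (k / S) al be x) * slope V x <= k / 6 * (384 * wt x))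
      by (apply Rmult_le_compat; auto; try lra; apply Rabs_pos).
    replace (F x - defect (k / S) al be x * slope V x - 2 * ell x)
      with ((F x - 2 * ell x) + - (defect (k / S) al be x * slope V x)) by ring.
    eapply Rle_trans; [apply Rabs_triang|].
    rewrite Rabs_Ropp, Rabs_mult, (Rabs_pos_eq (slope V x)) by lra.
    pose proof (msig_pow4_pos x).
    assert (0 <= k * wt x) by (apply Rmult_le_pos; lra).
    unfold r in *. simpl pow in *. lra.
  - intro x.
    pose proof (y_bound _ _ _ _ _ _ _ HR x) as Hy. specialize (Hmu x).
    pose proof (adm_w_bounds r w Th H1 H2 HA x). pose proof (msig_pow4_pos x).
    assert (HB : Rabs (w x * defect (k / S) al be x) <= 3 * (k / 6)).
    { rewrite Rabs_mult. apply Rmult_le_compat; auto using Rabs_pos. rewrite Rabs_pos_eq; lra. }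
    apply Rabs_le_between in Hy. apply Rabs_le_between in HB.
    apply Rabs_le. unfold r. simpl pow. lra.
Qed.

(** The factor [49 / 100] comes from [F]; all other differences carry [k * wt_max], at most
    [10 ^ -12], and fit easily into the slack up to [3 / 4]. *)
Lemma step_contracts k N w Th wn Thn V C F S al be y w' Th' wn' Thn' V' C' F' S' al' be' y' :
  small k -> 0 <= N -> wt_close N w Th w' Th' ->
  admissible (2 * 10 ^ 5 * k) w Th -> admissible (2 * 10 ^ 5 * k) w' Th' ->
  is_step k w Th wn Thn V C F S al be y -> is_step k w' Th' wn' Thn' V' C' F' S' al' be' y' ->
  wt_close (3 / 4 * N) wn Thn wn' Thn'.
Proof.
  intros Hk HN Hcl HA HA' [HP [HS [HR [Hwn HTn]]]] [HP' [HS' [HR' [Hwn' HTn']]]].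
  destruct (small_radius k Hk) as [H1 [H2 [H3 H4]]].
  set (r := 2 * 10 ^ 5 * k) in *.
  assert (Hkap := kap_bounds k S (proj1 Hk) (proj1 HS)).
  assert (Hkap' := kap_bounds k S' (proj1 Hk) (proj1 HS')).
  pose proof (adm_Th_bounds r w' Th' H1 H2 HA') as HTh'.
  assert (Hrat : Rabs (1 - k / S / (k / S')) <= 513 * (wt_max * N)).
  { apply kap_ratio; try lra. rewrite <- Rmult_assoc.
    apply (S_close N w Th V C F S w' Th' V' C' F' S'); auto. }
  destruct (response_close r N k (k / S) (k / S') w Th V C F S al be y w' Th' V' C' F' S' al' be' y')
    as [Hmu Hy]; auto.
  pose proof (F_close N w Th V C F S w' Th' V' C' F' S' HN HTh' HP HP' Hcl) as HF.
  pose proof (slope_close_wt N w Th V C F S w' Th' V' C' F' S' HN HP HP' Hcl) as Hp.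
  destruct Hcl as [Hcw HcT]. destruct Hk as [Hk HkE]. pose proof wt_max_ge1 as HE.
  assert (HkEN : k * (wt_max * N) <= / 10 ^ 12 * N).
  { replace (k * (wt_max * N)) with (wt_max * k * N) by ring. apply Rmult_le_compat_r; lra. }
  assert (HkN : k * N <= k * (wt_max * N)) by (apply Rmult_le_compat_l; [lra | nra]).
  assert (HkN0 : 0 <= k * N) by nra.
  assert (Hmb : forall x, Rabs (defect (k / S') al' be' x) <= k / 6).
  { intro x. eapply Rle_trans.
    - apply defect_bound; [lra | apply (al_bound _ _ _ _ _ _ _ HR') | apply (be_bound _ _ _ _ _ _ _ HR')].
    - lra. }
  split; intro x; specialize (Hmu x); specialize (Hmb x); specialize (Hcw x).
  - rewrite Hwn, Hwn'. specialize (HF x). specialize (Hp x).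
    pose proof (proj1 (slope_le_msig V x (prim_V_bound _ _ _ _ _ _ HP x))).
    pose proof (slope_pos V x). pose proof (wt_bounds x). pose proof (msig_pow4_pos x).
    assert (HD : Rabs (defect (k / S) al be x * slope V x - defect (k / S') al' be' x * slope V' x)
      <= 1000 * (k * (wt_max * N)) * (384 * wt x) + k / 6 * (384 * N * wt x)).
    { apply Rabs_mult_sub_le; auto. rewrite Rabs_pos_eq; lra. }
    replace (F x - defect (k / S) al be x * slope V x - (F' x - defect (k / S') al' be' x * slope V' x))
      with ((F x - F' x) + - (defect (k / S) al be x * slope V x - defect (k / S') al' be' x * slope V' x)) by ring.
    eapply Rle_trans; [apply Rabs_triang|]. rewrite Rabs_Ropp.
    assert (0 <= wt x) by lra.
    assert (k * (wt_max * N) * wt x <= / 10 ^ 12 * N * wt x) by (apply Rmult_le_compat_r; lra).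
    assert (k * N * wt x <= k * (wt_max * N) * wt x) by (apply Rmult_le_compat_r; lra).
    assert (0 <= N * wt x) by (apply Rmult_le_pos; lra).
    simpl pow in *. lra.
  - rewrite HTn, HTn'. specialize (Hy x).
    pose proof (adm_w_bounds r w Th H1 H2 HA x). pose proof (adm_w_bounds r w' Th' H1 H2 HA' x).
    pose proof (msig_pow4_pos x).
    assert (HD : Rabs (defect (k / S) al be x * w x - defect (k / S') al' be' x * w' x)
      <= 1000 * (k * (wt_max * N)) * 3 + k / 6 * (wt_max * N)).
    { apply Rabs_mult_sub_le; auto; [rewrite Rabs_pos_eq; lra|].
      eapply Rle_trans; [apply Hcw|]. pose proof (wt_bounds x). pose proof (msig_pow4_le x).
      pose proof (msig_bounds x). assert (wt x <= wt_max) by nra. nra. }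
    apply Rabs_le_between in HD. apply Rabs_le_between in Hy.
    apply Rabs_le. simpl pow in *. lra.
Qed.

(** A pair of functions is one function on [R + R], so a single sup norm measures both components,
    each with its own scale. *)
Definition index_weight (i : R + R) : R :=
  match i with inl x => wt x | inr _ => 1 / 1600 end.

Lemma admissible_base r : 0 <= r -> admissible r (fun x => 2 * ell x) (fun _ => 1 / 3).
Proof.
  intro Hr. constructor; intro x.
  - apply continuous_Rmult; [apply continuous_Rconst | apply ell_continuous].
  - apply continuous_Rconst.
  - rewrite Rminus_diag, Rabs_R0. pose proof (wt_bounds x). pose proof (msig_pow4_pos x).
    apply Rmult_le_pos; lra.
  - rewrite Rminus_diag, Rabs_R0. lra.
Qed.

Lemma fixed_step_exists k : small k ->
  exists w Th V C F S al be y,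
    admissible (2 * 10 ^ 5 * k) w Th /\ is_step k w Th w Th V C F S al be y.
Proof.
  intro Hk. destruct (small_radius k Hk) as [H1 [H2 [H3 H4]]].
  set (r := 2 * 10 ^ 5 * k) in *. pose proof wt_max_ge1 as HE.
  assert (Hwt : forall x, 0 < wt x <= wt_max).
  { intro x. pose proof (wt_bounds x). pose proof (msig_pow4_pos x). pose proof (msig_pow4_le x).
    pose proof (msig_bounds x). split; nra. }
  set (A := fun X : R + R -> R => admissible r (fun x => X (inl x)) (fun x => X (inr x))).
  set (T := fun X X' : R + R -> R => exists V C F S al be y,
    is_step k (fun x => X (inl x)) (fun x => X (inr x)) (fun x => X' (inl x)) (fun x => X' (inr x))
      V C F S al be y).
  destruct (weighted_fixed_point index_weight A T (2 * r) (3 / 4)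
    (fun i => match i with inl x => 2 * ell x | inr _ => 1 / 3 end)) as [X [X' [HX [HT HXX]]]].
  - intros [x|x]; simpl; [specialize (Hwt x)|]; lra.
  - lra.
  - lra.
  - apply (admissible_base r H1).
  - intros X HX. destruct (step_exists k _ _ Hk HX) as [wn [Thn [V [C [F [S [al [be [y [HA Hs]]]]]]]]]].
    exists (fun i => match i with inl x => wn x | inr x => Thn x end).
    split; [exact HA|]. exists V, C, F, S, al, be, y. exact Hs.
  - intros X Y HX HY [x|x]; simpl.
    + pose proof (adm_w _ _ _ HX x) as G1. pose proof (adm_w _ _ _ HY x) as G2. simpl in *.
      apply Rabs_le_between in G1. apply Rabs_le_between in G2. apply Rabs_le. lra.
    + pose proof (adm_Th _ _ _ HX x) as G1. pose proof (adm_Th _ _ _ HY x) as G2. simpl in *.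
      apply Rabs_le_between in G1. apply Rabs_le_between in G2. apply Rabs_le. lra.
  - intros X Y X' Y' N HX HY [V [C [F [S [al [be [y HS]]]]]]] [V' [C' [F' [S' [al' [be' [y' HS']]]]]]] HN Hc.
    assert (Hcl : wt_close N (fun x => X (inl x)) (fun x => X (inr x)) (fun x => Y (inl x)) (fun x => Y (inr x))).
    { split; intro x; [apply (Hc (inl x))|]. specialize (Hc (inr x)). simpl in Hc. lra. }
    destruct (step_contracts _ _ _ _ _ _ _ _ _ _ _ _ _ _ _ _ _ _ _ _ _ _ _ _
      Hk (proj1 HN) Hcl HX HY HS HS') as [Q1 Q2].
    intros [x|x]; [apply Q1|]. specialize (Q2 x). simpl. lra.
  - intros Xn X HXn HX.
    assert (Hq : 0 <= 3 / 4 < 1) by lra.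
    constructor.
    + apply (continuous_geometric_limit (fun n x => Xn n (inl x)) _ (2 * r * wt_max) (3 / 4) Hq).
      * intro n. apply (adm_w_continuous _ _ _ (HXn n)).
      * intros n x. eapply Rle_trans; [apply (HX n (inl x))|]. simpl.
        assert (0 <= (3 / 4) ^ n) by (apply pow_le; lra). specialize (Hwt x).
        replace (2 * r * wt_max * (3 / 4) ^ n) with (2 * r * (3 / 4) ^ n * wt_max) by ring.
        apply Rmult_le_compat_l; [apply Rmult_le_pos; lra | lra].
    + apply (continuous_geometric_limit (fun n x => Xn n (inr x)) _ (2 * r) (3 / 4) Hq).
      * intro n. apply (adm_Th_continuous _ _ _ (HXn n)).
      * intros n x. eapply Rle_trans; [apply (HX n (inr x))|]. simpl.
        assert (0 <= 2 * r * (3 / 4) ^ n) by (apply Rmult_le_pos; [lra | apply pow_le; lra]). lra.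
    + intro x. apply (le_geometric_limit _ _ (2 * r * wt x) (3 / 4) Hq). intro n.
      pose proof (adm_w _ _ _ (HXn n) x) as G1. pose proof (HX n (inl x)) as G2. simpl in *.
      replace (X (inl x) - 2 * ell x)
        with ((Xn n (inl x) - 2 * ell x) - (Xn n (inl x) - X (inl x))) by ring.
      eapply Rle_trans; [apply Rabs_triang|]. rewrite Rabs_Ropp. lra.
    + intro x. apply (le_geometric_limit _ _ (2 * r / 1600) (3 / 4) Hq). intro n.
      pose proof (adm_Th _ _ _ (HXn n) x) as G1. pose proof (HX n (inr x)) as G2. simpl in *.
      replace (X (inr x) - 1 / 3)
        with ((Xn n (inr x) - 1 / 3) - (Xn n (inr x) - X (inr x))) by ring.
      eapply Rle_trans; [apply Rabs_triang|]. rewrite Rabs_Ropp. lra.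
  - destruct HT as [V [C [F [S [al [be [y [HP [HS [HR [Hwn HTn]]]]]]]]]]].
    (* [X] and [X'] agree only pointwise, which suffices: a step mentions the new pair only through
       pointwise formulas. *)
    exists (fun x => X (inl x)), (fun x => X (inr x)), V, C, F, S, al, be, y.
    split; [exact HX|]. split; [exact HP|]. split; [exact HS|]. split; [exact HR|]. split.
    + intro x. rewrite HXX. apply Hwn.
    + intro x. rewrite (HXX (inr x)). apply HTn.
Qed.

(** * From profiles to traveling waves; reflection and scaling *)

(** The derivatives are parameters, so that the partial derivatives of the moving fields follow from
    the chain rule alone. The second velocity is eliminated as [- u]. *)
Record wave_profile (l v : R) (c1 c2 u q c1d c1dd c2d c2dd : R -> R) : Prop := {
  wp_c1 : forall z, is_derive c1 z (c1d z);
  wp_c1d : forall z, is_derive c1d z (c1dd z);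
  wp_c2 : forall z, is_derive c2 z (c2d z);
  wp_c2d : forall z, is_derive c2d z (c2dd z);
  wp_u : forall z, is_derive u z (q z / l ^ 2);
  wp_q : forall z, is_derive q z (2 * u z + c1 z - c2 z);
  wp_eq1 : forall z, - v * c1d z + (q z / l ^ 2 * c1 z + u z * c1d z) - c1dd z
    = - fterm l (c1 z) (c2 z) (q z);
  wp_eq2 : forall z, - v * c2d z - (q z / l ^ 2 * c2 z + u z * c2d z) - c2dd z
    = fterm l (c1 z) (c2 z) (q z) }.

Definition profile_state (c1 c2 u q : R -> R) (z : R) : state5 :=
  mkState (c1 z) (c2 z) (u z) (- u z) (q z).

Lemma is_derive_space (f : R -> R) (d v t y : R) :
  is_derive f (y - v * t) d -> is_derive (fun z => f (z - v * t)) y d.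
Proof.
  intro H. auto_derive; [eexists; exact H|].
  change (y + - (v * t)) with (y - v * t).
  rewrite (is_derive_unique (fun t : R => f t) _ _ H). ring.
Qed.

Lemma is_derive_time (f : R -> R) (d v t y : R) :
  is_derive f (y - v * t) d -> is_derive (fun s => f (y - v * s)) t (- v * d).
Proof.
  intro H. auto_derive; [eexists; exact H|].
  change (y + - (v * t)) with (y - v * t).
  rewrite (is_derive_unique (fun t : R => f t) _ _ H). ring.
Qed.

Lemma is_derive_Rmult (f g : R -> R) (x a b : R) :
  is_derive f x a -> is_derive g x b -> is_derive (fun t : R => f t * g t) x (a * g x + f x * b).
Proof.
  intros Hf Hg. apply (is_derive_mult f g x a b Hf Hg). intros; apply Rmult_comm.
Qed.

Lemma is_derive_Ropp (f : R -> R) (x a : R) :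
  is_derive f x a -> is_derive (fun t : R => - f t) x (- a).
Proof. apply (is_derive_opp (K := R_AbsRing) (V := R_NormedModule)). Qed.

Lemma wave_profile_solution l v c1 c2 u q c1d c1dd c2d c2dd :
  wave_profile l v c1 c2 u q c1d c1dd c2d c2dd ->
  let g := profile_state c1 c2 u q in
  is_solution l (tw_field g v sc1) (tw_field g v sc2) (tw_field g v su1)
    (tw_field g v su2) (tw_field g v sq).
Proof.
  intros H g t y _. unfold tw_field, g, profile_state. simpl.
  set (x := y - v * t).
  assert (Hy1 : forall z, is_derive (fun z : R => c1 (z - v * t)) z (c1d (z - v * t)))
    by (intro z; apply is_derive_space, (wp_c1 _ _ _ _ _ _ _ _ _ _ H)).
  assert (Hy2 : forall z, is_derive (fun z : R => c2 (z - v * t)) z (c2d (z - v * t)))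
    by (intro z; apply is_derive_space, (wp_c2 _ _ _ _ _ _ _ _ _ _ H)).
  assert (Hyy1 : is_derive (fun z : R => c1d (z - v * t)) y (c1dd x))
    by (apply is_derive_space, (wp_c1d _ _ _ _ _ _ _ _ _ _ H)).
  assert (Hyy2 : is_derive (fun z : R => c2d (z - v * t)) y (c2dd x))
    by (apply is_derive_space, (wp_c2d _ _ _ _ _ _ _ _ _ _ H)).
  assert (Hu : is_derive (fun z : R => u (z - v * t)) y (q x / l ^ 2))
    by (apply is_derive_space, (wp_u _ _ _ _ _ _ _ _ _ _ H)).
  assert (Hq : is_derive (fun z : R => q (z - v * t)) y (2 * u x + c1 x - c2 x))
    by (apply is_derive_space, (wp_q _ _ _ _ _ _ _ _ _ _ H)).
  assert (Ht1 : is_derive (fun s : R => c1 (y - v * s)) t (- v * c1d x))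
    by (apply is_derive_time, (wp_c1 _ _ _ _ _ _ _ _ _ _ H)).
  assert (Ht2 : is_derive (fun s : R => c2 (y - v * s)) t (- v * c2d x))
    by (apply is_derive_time, (wp_c2 _ _ _ _ _ _ _ _ _ _ H)).
  assert (Hyy1' : is_derive (fun z : R => dy (fun t y => c1 (y - v * t)) t z) y (c1dd x)).
  { apply (is_derive_ext (fun z => c1d (z - v * t))); [| exact Hyy1].
    intro z. symmetry. apply is_derive_unique, Hy1. }
  assert (Hyy2' : is_derive (fun z : R => dy (fun t y => c2 (y - v * t)) t z) y (c2dd x)).
  { apply (is_derive_ext (fun z => c2d (z - v * t))); [| exact Hyy2].
    intro z. symmetry. apply is_derive_unique, Hy2. }
  assert (Hf1 := is_derive_Rmult _ _ _ _ _ Hu (Hy1 y)).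
  assert (Hf2 := is_derive_Rmult _ _ _ _ _ (is_derive_Ropp _ _ _ Hu) (Hy2 y)).
  fold x in Hf1, Hf2.
  repeat match goal with |- _ /\ _ => split end.
  - eexists; exact Ht1.
  - eexists; exact Ht2.
  - eexists; apply Hy1.
  - eexists; apply Hy2.
  - eexists; exact Hyy1'.
  - eexists; exact Hyy2'.
  - eexists; exact Hf1.
  - eexists; exact Hf2.
  - eexists; exact Hq.
  - eexists; exact Hu.
  - unfold dt. rewrite (is_derive_unique _ _ _ Ht1).
    unfold dy at 1. rewrite (is_derive_unique _ _ _ Hf1).
    unfold dy at 1. rewrite (is_derive_unique _ _ _ Hyy1').
    apply (wp_eq1 _ _ _ _ _ _ _ _ _ _ H).
  - unfold dt. rewrite (is_derive_unique _ _ _ Ht2).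
    unfold dy at 1. rewrite (is_derive_unique _ _ _ Hf2).
    unfold dy at 1. rewrite (is_derive_unique _ _ _ Hyy2').
    rewrite <- (wp_eq2 _ _ _ _ _ _ _ _ _ _ H x). fold x. ring.
  - unfold dy. rewrite (is_derive_unique _ _ _ Hq). ring.
  - unfold dy. rewrite (is_derive_unique _ _ _ Hu). reflexivity.
  - ring.
Qed.

Definition profile_limits (c1 c2 u q : R -> R) (x : Rbar) (b1 b2 b : R) : Prop :=
  is_lim c1 x b1 /\ is_lim c2 x b2 /\ is_lim u x b /\ is_lim q x 0.

Lemma wave_profile_traveling_wave l v c1 c2 u q c1d c1dd c2d c2dd a1 a2 a b1 b2 b :
  wave_profile l v c1 c2 u q c1d c1dd c2d c2dd ->
  profile_limits c1 c2 u q m_infty a1 a2 a -> profile_limits c1 c2 u q p_infty b1 b2 b ->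
  traveling_wave l (profile_state c1 c2 u q) v
    (mkState a1 a2 a (- a) 0) (mkState b1 b2 b (- b) 0).
Proof.
  intros H [L1 [L2 [L3 L4]]] [M1 [M2 [M3 M4]]]. split; [|split; [|split]].
  - intro z. simpl. repeat match goal with |- _ /\ _ => split end.
    + eapply continuous_of_derive, (wp_c1 _ _ _ _ _ _ _ _ _ _ H).
    + eapply continuous_of_derive, (wp_c2 _ _ _ _ _ _ _ _ _ _ H).
    + eapply continuous_of_derive, (wp_u _ _ _ _ _ _ _ _ _ _ H).
    + eapply continuous_of_derive, is_derive_Ropp, (wp_u _ _ _ _ _ _ _ _ _ _ H).
    + eapply continuous_of_derive, (wp_q _ _ _ _ _ _ _ _ _ _ H).
  - apply (wave_profile_solution _ _ _ _ _ _ _ _ _ _ H).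
  - repeat split; simpl; auto. now apply (is_lim_opp u m_infty a).
  - repeat split; simpl; auto. now apply (is_lim_opp u p_infty b).
Qed.

(** A constant is a profile of speed [0]; the exchange term vanishes with [q]. *)
Lemma stationary_state l c1 c2 u u2 : u + u2 = 0 -> 2 * u + c1 - c2 = 0 ->
  stationary l (mkState c1 c2 u u2 0).
Proof.
  intros Hu Hq. replace u2 with (- u) by lra.
  apply (wave_profile_solution l 0 (fun _ => c1) (fun _ => c2) (fun _ => u) (fun _ => 0)
    (fun _ => 0) (fun _ => 0) (fun _ => 0) (fun _ => 0)).
  assert (Hc : forall a z : R, is_derive (fun _ : R => a) z 0)
    by (intros; apply (is_derive_const (K := R_AbsRing) (V := R_NormedModule))).
  constructor; intro z; auto.
  - unfold Rdiv. rewrite Rmult_0_l. apply Hc.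
  - rewrite Hq. apply Hc.
  - unfold fterm, Rdiv. rewrite Ropp_0, !Rmult_0_l. destruct (Rle_dec 0 0); ring.
  - unfold fterm, Rdiv. rewrite Ropp_0, !Rmult_0_l. destruct (Rle_dec 0 0); ring.
Qed.

Lemma fterm_nonpos l c1 c2 q : 0 < l -> q <= 0 -> fterm l c1 c2 q = - q / l ^ 2 * c1.
Proof.
  intros Hl Hq. unfold fterm.
  assert (0 <= - q / l) by (apply Rmult_le_pos; [lra | left; apply Rinv_0_lt_compat; lra]).
  destruct (Rle_dec 0 (- q / l)); [|lra]. field. lra.
Qed.

(** Negating [q] reverses the exchange and thereby selects the other concentration. When the
    exchange vanishes, both sides fall into the first branch, and both are zero. *)
Lemma fterm_mirror l c1 c2 q : 0 < l -> fterm l (- c2) (- c1) (- q) = fterm l c1 c2 q.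
Proof.
  intro Hl. assert (Hi : 0 < / l) by (apply Rinv_0_lt_compat; lra).
  unfold fterm, Rdiv. rewrite Ropp_involutive.
  destruct (Rle_dec 0 (q * / l)), (Rle_dec 0 (- q * / l)); try ring.
  - assert (q * / l = 0) as Hz by lra. replace (- q * / l) with (- (q * / l)) by ring.
    rewrite Hz. ring.
  - lra.
Qed.

(* The equations are invariant under [y -> -y], [c1 -> -c2], [c2 -> -c1]. *)
Lemma wave_profile_mirror l v c1 c2 u q c1d c1dd c2d c2dd : 0 < l ->
  wave_profile l v c1 c2 u q c1d c1dd c2d c2dd ->
  wave_profile l (- v) (fun z => - c2 (- z)) (fun z => - c1 (- z)) (fun z => u (- z))
    (fun z => - q (- z)) (fun z => c2d (- z)) (fun z => - c2dd (- z))
    (fun z => c1d (- z)) (fun z => - c1dd (- z)).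
Proof.
  intros Hl H. constructor; intro z.
  - replace (c2d (- z)) with (- - c2d (- z)) by ring.
    apply is_derive_Ropp, is_derive_reflect, (wp_c2 _ _ _ _ _ _ _ _ _ _ H).
  - apply is_derive_reflect, (wp_c2d _ _ _ _ _ _ _ _ _ _ H).
  - replace (c1d (- z)) with (- - c1d (- z)) by ring.
    apply is_derive_Ropp, is_derive_reflect, (wp_c1 _ _ _ _ _ _ _ _ _ _ H).
  - apply is_derive_reflect, (wp_c1d _ _ _ _ _ _ _ _ _ _ H).
  - replace (- q (- z) / l ^ 2) with (- (q (- z) / l ^ 2)) by (field; lra).
    apply is_derive_reflect, (wp_u _ _ _ _ _ _ _ _ _ _ H).
  - replace (2 * u (- z) + - c2 (- z) - - c1 (- z))
      with (- - (2 * u (- z) + c1 (- z) - c2 (- z))) by ring.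
    apply is_derive_Ropp, is_derive_reflect, (wp_q _ _ _ _ _ _ _ _ _ _ H).
  - rewrite fterm_mirror, <- (wp_eq2 _ _ _ _ _ _ _ _ _ _ H (- z)) by lra. field. lra.
  - rewrite fterm_mirror by lra.
    replace (fterm l (c1 (- z)) (c2 (- z)) (q (- z)))
      with (- - fterm l (c1 (- z)) (c2 (- z)) (q (- z))) by ring.
    rewrite <- (wp_eq1 _ _ _ _ _ _ _ _ _ _ H (- z)). field. lra.
Qed.

Lemma is_lim_reflect (f : R -> R) (x : Rbar) (L : R) : x = m_infty \/ x = p_infty ->
  is_lim f (Rbar_opp x) L -> is_lim (fun z => f (- z)) x L.
Proof.
  intros Hx Hf. apply (is_lim_comp f (fun z => - z) x L (Rbar_opp x)); auto.
  - apply is_lim_opp, is_lim_id.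
  - destruct Hx as [-> | ->]; exists 0; intros; discriminate.
Qed.

Lemma profile_limits_mirror c1 c2 u q x b1 b2 b : x = m_infty \/ x = p_infty ->
  profile_limits c1 c2 u q (Rbar_opp x) b1 b2 b ->
  profile_limits (fun z => - c2 (- z)) (fun z => - c1 (- z)) (fun z => u (- z))
    (fun z => - q (- z)) x (- b2) (- b1) b.
Proof.
  intros Hx [H1 [H2 [H3 H4]]]. repeat split.
  - apply (is_lim_opp (fun z => c2 (- z)) x b2). now apply is_lim_reflect.
  - apply (is_lim_opp (fun z => c1 (- z)) x b1). now apply is_lim_reflect.
  - now apply is_lim_reflect.
  - replace (Finite 0) with (Rbar_opp 0) by (simpl; f_equal; ring).
    apply (is_lim_opp (fun z => q (- z)) x 0). now apply is_lim_reflect.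
Qed.

Lemma is_derive_rescale (f : R -> R) (a b d z : R) :
  is_derive f (b * z) d -> is_derive (fun t => a * f (b * t)) z (a * b * d).
Proof.
  intro H. auto_derive; [eexists; exact H|].
  rewrite (is_derive_unique (fun t : R => f t) _ _ H). ring.
Qed.

Lemma is_lim_rescale (f : R -> R) (a b L : R) (x : Rbar) : 0 < b -> x = m_infty \/ x = p_infty ->
  is_lim f x L -> is_lim (fun z => a * f (b * z)) x (a * L).
Proof.
  intros Hb Hx Hf. apply (is_lim_scal_l (fun z => f (b * z)) a x L).
  apply (is_lim_comp f (fun z => b * z) x L x); auto.
  - assert (Hx' : Rbar_mult b x = x).
    { destruct Hx as [-> | ->]; simpl; destruct (Rle_dec 0 b) as [h|h]; try lra;
        destruct (Rle_lt_or_eq_dec 0 b h); auto; lra. }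
    rewrite <- Hx' at 2. apply is_lim_scal_l, is_lim_id.
  - destruct Hx as [-> | ->]; exists 0; intros; discriminate.
Qed.

(** * The first wave, built from a fixed point *)

(** At a fixed point the integrated formulas become the profile equations again. The last conclusion
    says [kap ^ 2 * w'' = - defect * slope V], so [w - kap ^ 2 * w'' = F], which is the second-order
    equation for [w] with [d / 2 = F]. *)
Lemma step_slopes k w Th V C F S al be y :
  0 < k / S -> is_step k w Th w Th V C F S al be y ->
  (forall x, is_derive w x (theta al be x * slope V x)) /\
  (forall x, is_derive Th x (2 * w x * Th x - w x + F x * theta al be x)) /\
  (forall x, is_derive (fun x => theta al be x * slope V x) x
     (- ((al x - be x) / (2 * (k / S))) * slope V x)).
Proof.
  intros Hk [HP [HS [HR [Hw HTh]]]]. set (kap := k / S) in *.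
  pose proof (prim_slope_derive _ _ _ _ _ _ HP) as Hp.
  assert (Hmu : forall x, is_derive (defect kap al be) x
    (Th x - theta al be x - (1 - w x) * defect kap al be x)).
  { intro x. unfold defect.
    pose proof (al_derive _ _ _ _ _ _ _ HR x) as Ha. pose proof (be_derive _ _ _ _ _ _ _ HR x) as Hb.
    auto_derive; [repeat split; eexists; eassumption|].
    rewrite (is_derive_unique (fun t : R => al t) _ _ Ha), (is_derive_unique (fun t : R => be t) _ _ Hb).
    unfold theta. field. lra. }
  assert (Hwd : forall x, is_derive w x (theta al be x * slope V x)).
  { intro x. apply (is_derive_ext (fun x => F x - defect kap al be x * slope V x));
      [intro t; symmetry; apply Hw|].
    replace (theta al be x * slope V x) with
      (Th x * slope V x - ((Th x - theta al be x - (1 - w x) * defect kap al be x) * slope V x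
        + defect kap al be x * ((1 - w x) * slope V x))) by ring.
    apply (is_derive_minus (K := R_AbsRing) (V := R_NormedModule) F).
    - apply (prim_F _ _ _ _ _ _ HP).
    - apply is_derive_Rmult; auto. }
  split; [exact Hwd|]. split.
  - intro x. apply (is_derive_ext (fun x => 1 / 3 + y x / 2 - w x * defect kap al be x));
      [intro t; symmetry; apply HTh|].
    pose proof (y_derive _ _ _ _ _ _ _ HR x) as Hy. specialize (Hwd x). specialize (Hmu x).
    auto_derive; [repeat split; eexists; eassumption|].
    rewrite (is_derive_unique (fun t : R => y t) _ _ Hy),
      (is_derive_unique (fun t : R => w t) _ _ Hwd),
      (is_derive_unique (fun t : R => defect kap al be t) _ _ Hmu).
    (* Here the fixed-point identities enter: they eliminate [F] and [y], and the source of [y] was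
       designed so that the terms with [defect] cancel. *)
    replace (F x) with (w x + defect kap al be x * slope V x) by (rewrite (Hw x); ring).
    replace (y x) with (2 * Th x - 2 / 3 + 2 * w x * defect kap al be x) by (rewrite (HTh x); field).
    unfold source. field.
  - intro x.
    pose proof (al_derive _ _ _ _ _ _ _ HR x) as Ha. pose proof (be_derive _ _ _ _ _ _ _ HR x) as Hb.
    specialize (Hp x). unfold theta.
    auto_derive; [repeat split; eexists; eassumption|].
    rewrite (is_derive_unique (fun t : R => al t) _ _ Ha), (is_derive_unique (fun t : R => be t) _ _ Hb),
      (is_derive_unique (fun t : R => slope V t) _ _ Hp).
    field. lra.
Qed.

(** While [q <= 0], the exchange cancels the undifferentiated [c1] in its equation, and elsewhere
    only derivatives and [c1 - c2] occur. The shift by [-1] is therefore harmless, and dividing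
    amplitudes and argument by [S] turns speed [-1] into [- / S] and the length [k / S] into the
    prescribed [k]. *)
Lemma step_wave_profile l k w Th V C F S al be y :
  0 < l -> 0 < k -> l ^ 2 = 2 * k ^ 2 -> is_step k w Th w Th V C F S al be y ->
  wave_profile l (- / S)
    (fun z => -1 + / S * C (/ S * z))
    (fun z => -1 + / S * (C (/ S * z) - 2 * F (/ S * z)))
    (fun z => - / S * w (/ S * z))
    (fun z => - l ^ 2 * (/ S) ^ 2 * (theta al be (/ S * z) * slope V (/ S * z)))
    (fun z => (/ S) ^ 2 * slope V (/ S * z))
    (fun z => (/ S) ^ 3 * ((1 - w (/ S * z)) * slope V (/ S * z)))
    (fun z => (/ S) ^ 2 * ((1 - 2 * Th (/ S * z)) * slope V (/ S * z)))
    (fun z => (/ S) ^ 3 * (((1 - 2 * Th (/ S * z)) * (1 - w (/ S * z))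
       - 2 * (2 * w (/ S * z) * Th (/ S * z) - w (/ S * z) + F (/ S * z) * theta al be (/ S * z)))
       * slope V (/ S * z))).
Proof.
  intros Hl Hk Hlk Hstep.
  assert (HS : 3 <= S <= 5) by apply Hstep.
  assert (Hkap := kap_bounds k S Hk (proj1 HS)).
  destruct (step_slopes k w Th V C F S al be y (proj1 Hkap) Hstep) as [Hwd [HTd Htp]].
  destruct Hstep as [HP [_ [HR [Hw HTh]]]].
  pose proof (prim_slope_derive _ _ _ _ _ _ HP) as Hp.
  pose proof (prim_C _ _ _ _ _ _ HP) as HC. pose proof (prim_F _ _ _ _ _ _ HP) as HF.
  assert (HiS : 0 < / S) by (apply Rinv_0_lt_compat; lra).
  assert (Hshift : forall (f : R -> R) z d, is_derive f z d -> is_derive (fun t => -1 + f t) z d).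
  { intros f z d Hf. replace d with (0 + d) by ring.
    apply (is_derive_plus (K := R_AbsRing) (V := R_NormedModule) (fun _ => -1) f); auto.
    apply (is_derive_const (K := R_AbsRing) (V := R_NormedModule)). }
  (* The sign of [q] selects the branch of the exchange term with [c1]; it rests on [theta >= 0] and
     [slope > 0]. *)
  assert (Hq0 : forall z, - l ^ 2 * (/ S) ^ 2 * (theta al be z * slope V z) <= 0).
  { intro z. pose proof (theta_bounds _ _ _ _ _ _ _ HR z). pose proof (slope_pos V z).
    assert (0 <= theta al be z * slope V z) by (apply Rmult_le_pos; lra).
    assert (0 <= l ^ 2 * (/ S) ^ 2) by (apply Rmult_le_pos; apply pow2_ge_0).
    assert (0 <= l ^ 2 * (/ S) ^ 2 * (theta al be z * slope V z)) by (apply Rmult_le_pos; lra).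
    lra. }
  constructor; intro z; set (x := / S * z).
  - apply Hshift. replace ((/ S) ^ 2) with (/ S * / S) by ring. apply is_derive_rescale, HC.
  - replace ((/ S) ^ 3) with ((/ S) ^ 2 * / S) by ring. apply is_derive_rescale, Hp.
  - apply Hshift. replace ((/ S) ^ 2) with (/ S * / S) by ring.
    apply (is_derive_rescale (fun x => C x - 2 * F x)).
    replace ((1 - 2 * Th x) * slope V x) with (slope V x - 2 * (Th x * slope V x)) by ring.
    apply (is_derive_minus (K := R_AbsRing) (V := R_NormedModule) C (fun x => 2 * F x)); [apply HC|].
    apply is_derive_scal, HF.
  - replace ((/ S) ^ 3) with ((/ S) ^ 2 * / S) by ring.
    apply (is_derive_rescale (fun x => (1 - 2 * Th x) * slope V x)). fold x.
    specialize (HTd x). specialize (Hp x).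
    auto_derive; [repeat split; eexists; eassumption|].
    rewrite (is_derive_unique (fun t : R => Th t) _ _ HTd),
      (is_derive_unique (fun t : R => slope V t) _ _ Hp). ring.
  - replace (- l ^ 2 * (/ S) ^ 2 * (theta al be x * slope V x) / l ^ 2)
      with (- / S * / S * (theta al be x * slope V x)) by (field; lra).
    apply is_derive_rescale, Hwd.
  - replace (2 * (- / S * w x) + (-1 + / S * C x) - (-1 + / S * (C x - 2 * F x)))
      with (- l ^ 2 * (/ S) ^ 2 * / S * (- ((al x - be x) / (2 * (k / S))) * slope V x)).
    + apply (is_derive_rescale (fun x => theta al be x * slope V x)), Htp.
    + rewrite Hlk, (Hw x). unfold defect. field. lra.
  - rewrite fterm_nonpos by (auto; apply Hq0). field. lra.
  - rewrite fterm_nonpos by (auto; apply Hq0). field. lra.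
Qed.

Lemma is_lim_slope V x : (forall z, Rabs (V z) <= - ln (1 - msig z)) ->
  x = m_infty \/ x = p_infty -> is_lim (slope V) x 0.
Proof.
  intros HV [-> | ->].
  - apply (lim_zero_of_abs_le _ (fun z => 384 * msig z)); [| apply is_lim_msig_m_infty; lra].
    intro z. pose proof (slope_pos V z). pose proof (proj1 (slope_le_msig V z (HV z))).
    pose proof (msig_pow4_le z). rewrite Rabs_pos_eq; lra.
  - apply (lim_zero_of_abs_le _ (fun z => 384 * (1 - msig z))); [| apply is_lim_one_sub_msig; lra].
    intro z. pose proof (slope_pos V z). pose proof (proj2 (slope_le_msig V z (HV z))).
    pose proof (msig_bounds z). rewrite Rabs_pos_eq by lra. nra.
Qed.

Lemma is_lim_bounded_slope (f V : R -> R) B x : (forall z, Rabs (V z) <= - ln (1 - msig z)) ->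
  x = m_infty \/ x = p_infty -> (forall z, Rabs (f z) <= B) ->
  is_lim (fun z => f z * slope V z) x 0.
Proof.
  intros HV Hx HB. apply (lim_zero_of_abs_le _ (fun z => B * slope V z)).
  - intro z. pose proof (slope_pos V z). rewrite Rabs_mult, (Rabs_pos_eq (slope V z)) by lra.
    apply Rmult_le_compat_r; [lra | apply HB].
  - replace (Finite 0) with (Rbar_mult B 0) by (simpl; f_equal; ring).
    apply is_lim_scal_l. now apply is_lim_slope.
Qed.

(** [w] and [F] share their limits because [defect * slope V] vanishes at both ends. At [+oo], [C]
    tends to [S + Finf] and [C - 2 F] to [S - Finf], so after division by [S] and the shift by [-1]
    the concentrations tend to opposite values. *)
Lemma step_limits k w Th V C F S al be y : small k -> admissible (2 * 10 ^ 5 * k) w Th ->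
  is_step k w Th w Th V C F S al be y ->
  exists Finf : R, Rabs (Finf - 2) <= wt_max * (2 * 10 ^ 5 * k) /\
    is_lim F p_infty Finf /\ is_lim C p_infty (S + Finf) /\ is_lim w p_infty Finf /\
    is_lim F m_infty 0 /\ is_lim C m_infty 0 /\ is_lim w m_infty 0.
Proof.
  intros Hk HA [HP [HS [HR [Hw HTh]]]].
  destruct (small_radius k Hk) as [H1 [H2 [H3 H4]]].
  set (r := 2 * 10 ^ 5 * k) in *. pose proof wt_max_ge1.
  assert (Hkap := kap_bounds k S (proj1 Hk) (proj1 HS)).
  pose proof (adm_Th_bounds r w Th H1 H2 HA) as HT.
  pose proof (prim_V_bound _ _ _ _ _ _ HP) as HV.
  assert (Hmp : forall x, x = m_infty \/ x = p_infty ->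
    is_lim (fun z => defect (k / S) al be z * slope V z) x 0).
  { intros x Hx. apply (is_lim_bounded_slope _ _ 1); auto.
    intro z. eapply Rle_trans.
    - apply defect_bound; [lra | apply (al_bound _ _ _ _ _ _ _ HR) | apply (be_bound _ _ _ _ _ _ _ HR)].
    - lra. }
  assert (Hwl : forall x (L : R), x = m_infty \/ x = p_infty -> is_lim F x L -> is_lim w x L).
  { intros x L Hx HL.
    apply (is_lim_ext (fun z => F z - defect (k / S) al be z * slope V z)); [intro; symmetry; apply Hw|].
    replace (Finite L) with (Finite (L - 0)) by (f_equal; ring). apply is_lim_minus'; auto. }
  assert (Hpm : forall z, slope V z <= 1536 * (msig z * (1 - msig z) / 4)).
  { intro z. pose proof (proj2 (slope_le_msig V z (HV z))). lra. }
  destruct (ex_lim_p_infty_dominated F (fun x => Th x * slope V x) (fun x => 1536 * msig x)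
    (fun x => 1536 * (msig x * (1 - msig x) / 4)) 1536) as [Finf HFinf]; auto using msig_scal_derive.
  { apply (prim_F _ _ _ _ _ _ HP). }
  { intro z. specialize (Hpm z). specialize (HT z). pose proof (slope_pos V z).
    rewrite Rabs_pos_eq; nra. }
  { intro z. eapply Rle_trans; [apply (prim_F_bound _ _ _ _ _ _ HP)|]. pose proof (msig_bounds z). lra. }
  { intro z. pose proof (msig_bounds z). lra. }
  assert (HF0 : is_lim F m_infty 0).
  { eapply lim_zero_of_abs_le; [apply (prim_F_bound _ _ _ _ _ _ HP) | apply is_lim_msig_m_infty; lra]. }
  exists Finf. repeat split; auto.
  - apply (lim_close F (fun x => 2 * ell x)); auto; [apply is_lim_ell_p_infty|].
    intro x. eapply Rle_trans.
    + apply (F_close r w Th V C F S (fun x => 2 * ell x) (fun _ => 1 / 3) (fun _ => 0)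
        (fun x => 6 * ell x) (fun x => 2 * ell x) 4 H1);
        [| exact HP | apply primitives_base | now apply wt_close_base].
      intro; lra.
    + pose proof (wt_bounds x). pose proof (msig_pow4_pos x). pose proof (msig_pow4_le x).
      pose proof (msig_bounds x). assert (wt x <= wt_max) by nra. nra.
  - apply (is_lim_ext (fun x => (C x - F x) + F x)); [intro; ring|].
    apply is_lim_plus'; auto. apply (prim_S _ _ _ _ _ _ HP).
  - eapply lim_zero_of_abs_le; [apply (prim_C_bound _ _ _ _ _ _ HP) | apply is_lim_msig_m_infty; lra].
Qed.

Lemma is_lim_shift_rescale (f : R -> R) (a L : R) (x : Rbar) (L' : R) :
  0 < a -> x = m_infty \/ x = p_infty -> is_lim f x L -> -1 + a * L = L' ->
  is_lim (fun z => -1 + a * f (a * z)) x L'.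
Proof.
  intros Ha Hx Hf <-. apply is_lim_plus'; [apply is_lim_const|].
  now apply is_lim_rescale.
Qed.

Lemma first_wave l : 0 < l < / (10 ^ 12 * wt_max) ->
  exists a s c1 c2 u q c1d c1dd c2d c2dd,
    Rabs (a - 1 / 2) <= 10 ^ 9 * wt_max * l /\ Rabs (s - 1 / 4) <= 10 ^ 9 * wt_max * l /\ 0 < s /\
    wave_profile l (- s) c1 c2 u q c1d c1dd c2d c2dd /\
    profile_limits c1 c2 u q m_infty (-1) (-1) 0 /\
    profile_limits c1 c2 u q p_infty a (- a) (- a).
Proof.
  intros [Hl Hl0]. pose proof wt_max_ge1 as HE.
  (* The equations for [u] and [q] combine to [l ^ 2 * u'' = 2 * u + c1 - c2]; halving gives the
     relaxation length [l / sqrt 2]. *)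
  set (k := l / sqrt 2).
  assert (Hs2 : 1 <= sqrt 2) by (rewrite <- sqrt_1; apply sqrt_le_1; lra).
  assert (Hsq : sqrt 2 * sqrt 2 = 2) by (apply sqrt_sqrt; lra).
  assert (Hk0 : 0 < k) by (apply Rdiv_lt_0_compat; lra).
  assert (Hkl : k * sqrt 2 = l) by (unfold k; field; lra).
  assert (Hkl' : k <= l) by nra.
  assert (Hk2 : l ^ 2 = 2 * k ^ 2) by (transitivity (k ^ 2 * (sqrt 2 * sqrt 2)); [rewrite <- Hkl; ring | rewrite Hsq; ring]).
  assert (HEk : wt_max * k <= 1 / 10 ^ 12).
  { apply (Rle_trans _ (wt_max * / (10 ^ 12 * wt_max))); [apply Rmult_le_compat_l; lra|].
    right. field. lra. }
  assert (Hk : small k) by (split; assumption).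
  destruct (fixed_step_exists k Hk) as [w [Th [V [C [F [S [al [be [y [HA Hst]]]]]]]]]].
  destruct (small_radius k Hk) as [R1 [R2 [R3 R4]]].
  destruct (step_limits k w Th V C F S al be y Hk HA Hst)
    as [Finf [HFb [LF [LC [Lw [LF0 [LC0 Lw0]]]]]]].
  assert (HSb : Rabs (S - 4) <= 1537 * wt_max * (2 * 10 ^ 5 * k)).
  { apply (S_close _ w Th V C F S (fun x => 2 * ell x) (fun _ => 1 / 3) (fun _ => 0)
      (fun x => 6 * ell x) (fun x => 2 * ell x) 4 R1);
      [| apply Hst | apply primitives_base | now apply wt_close_base].
    intro; lra. }
  pose proof (step_wave_profile l k w Th V C F S al be y Hl Hk0 Hk2 Hst) as Hwp.
  destruct Hst as [HP [HS [HR _]]].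
  assert (HiS : 0 < / S) by (apply Rinv_0_lt_compat; lra).
  assert (HiS3 : / S <= / 3) by (apply Rinv_le_contravar; lra).
  assert (HsS : Rabs (/ S - 1 / 4) <= Rabs (S - 4)).
  { replace (/ S - 1 / 4) with (- (S - 4) * (/ S / 4)) by (field; lra).
    rewrite Rabs_mult, Rabs_Ropp, (Rabs_pos_eq (/ S / 4)) by lra.
    pose proof (Rabs_pos (S - 4)). nra. }
  assert (HEkl : wt_max * k <= wt_max * l) by (apply Rmult_le_compat_l; lra).
  assert (HEl : 0 <= wt_max * l) by (apply Rmult_le_pos; lra).
  assert (Hq : forall x, x = m_infty \/ x = p_infty ->
    is_lim (fun z => - l ^ 2 * (/ S) ^ 2 * (theta al be (/ S * z) * slope V (/ S * z))) x 0).
  { intros x Hx. replace 0 with (- l ^ 2 * (/ S) ^ 2 * 0) by ring.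
    apply (is_lim_rescale (fun z => theta al be z * slope V z)); auto.
    apply (is_lim_bounded_slope _ _ 1); auto.
    - apply (prim_V_bound _ _ _ _ _ _ HP).
    - intro z. pose proof (theta_bounds _ _ _ _ _ _ _ HR z). apply Rabs_le. lra. }
  exists (/ S * Finf), (/ S). do 8 eexists.
  split; [| split; [| split; [exact HiS | split; [exact Hwp | split; split; [| split; [| split] | | split; [| split]]]]]].
  (* The errors of [Finf] and [S] add up to [2 * 10 ^ 5 * (1 + 2 * 1537)], below [10 ^ 9]. *)
  - replace (/ S * Finf - 1 / 2) with (/ S * (Finf - 2) + 2 * (/ S - 1 / 4)) by (field; lra).
    eapply Rle_trans; [apply Rabs_triang|]. rewrite !Rabs_mult, (Rabs_pos_eq (/ S)), (Rabs_pos_eq 2) by lra.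
    pose proof (Rabs_pos (Finf - 2)).
    assert (/ S * Rabs (Finf - 2) <= Rabs (Finf - 2)) by nra.
    simpl pow in *. lra.
  - simpl pow in *. lra.
  - apply (is_lim_shift_rescale C (/ S) 0); auto. ring.
  - apply (is_lim_shift_rescale (fun z => C z - 2 * F z) (/ S) 0); auto; [|ring].
    replace (Finite 0) with (Finite (0 - 2 * 0)) by (f_equal; ring).
    apply is_lim_minus'; auto. apply (is_lim_scal_l F 2 m_infty 0 LF0).
  - replace 0 with (- / S * 0) by ring. apply is_lim_rescale; auto.
  - now apply Hq; left.
  - apply (is_lim_shift_rescale C (/ S) (S + Finf)); auto. field. lra.
  - apply (is_lim_shift_rescale (fun z => C z - 2 * F z) (/ S) (S + Finf - 2 * Finf)); auto.
    + apply is_lim_minus'; auto. apply (is_lim_scal_l F 2 p_infty Finf LF).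
    + field. lra.
  - replace (- (/ S * Finf)) with (- / S * Finf) by ring. apply is_lim_rescale; auto.
  - now apply Hq; right.
Qed.

(** * The limit of vanishing [l] and the terrace *)

Lemma filterlim_at_right_of_abs_le (f : R -> R) (L K d : R) : 0 < d -> 0 < K ->
  (forall l, 0 < l < d -> Rabs (f l - L) <= K * l) ->
  filterlim f (at_right 0) (locally L).
Proof.
  intros Hd HK H. apply filterlim_locally. intro eps.
  assert (Hm : 0 < Rmin d (eps / K)) by (apply Rmin_glb_lt; [lra | apply Rdiv_lt_0_compat; [apply cond_pos | lra]]).
  exists (mkposreal _ Hm). intros l Hb Hl.
  change (Rabs (l - 0) < Rmin d (eps / K)) in Hb. change (Rabs (f l - L) < eps).
  rewrite Rminus_0_r, Rabs_pos_eq in Hb by lra.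
  pose proof (Rmin_l d (eps / K)). pose proof (Rmin_r d (eps / K)).
  eapply Rle_lt_trans; [apply H; lra|].
  assert (Hle : l < eps / K) by lra. apply (Rmult_lt_compat_l K) in Hle; [|lra].
  replace (K * (eps / K)) with (pos eps) in Hle by (field; lra). exact Hle.
Qed.

Theorem theorem1 :
  exists l0 : R, 0 < l0 /\
  exists c1s c2s u1s u2s v1s v2s : R -> R,
    (forall l : R, 0 < l < l0 ->
       exists g1 g2 : R -> state5,
         propagating_terrace l 2
           (fun k => match k with
                     | O => mkState (-1) (-1) 0 0 0
                     | S O => mkState (c1s l) (c2s l) (u1s l) (u2s l) 0
                     | _ => mkState 1 1 0 0 0
                     end)
           (fun k => match k with S O => g1 | _ => g2 end)
           (fun k => match k with S O => v1s l | _ => v2s l end)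
           (mkState (-1) (-1) 0 0 0) (mkState 1 1 0 0 0)) /\
    filterlim c1s (at_right 0) (locally (1 / 2)) /\
    filterlim c2s (at_right 0) (locally (- (1 / 2))) /\
    filterlim v2s (at_right 0) (locally (1 / 4)) /\
    filterlim v1s (at_right 0) (locally (- (1 / 4))).
Proof.
  pose proof wt_max_ge1 as HE.
  set (l0 := / (10 ^ 12 * wt_max)).
  assert (Hl0 : 0 < l0) by (apply Rinv_0_lt_compat; apply Rmult_lt_0_compat; [apply pow_lt|]; lra).
  set (K := 10 ^ 9 * wt_max).
  assert (HK : 0 < K) by (apply Rmult_lt_0_compat; [apply pow_lt|]; lra).
  (* The middle state and the speeds must be functions of [l], so a pair is selected for each [l] by
     [epsilon]. Outside the range of [l] treated its value is irrelevant, as the limits only see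
     small [l]; the linear error bounds inside [Q] give these limits. *)
  pose (Q := fun l (as_ : R * R) => exists c1 c2 u q c1d c1dd c2d c2dd,
    Rabs (fst as_ - 1 / 2) <= K * l /\ Rabs (snd as_ - 1 / 4) <= K * l /\ 0 < snd as_ /\
    wave_profile l (- snd as_) c1 c2 u q c1d c1dd c2d c2dd /\
    profile_limits c1 c2 u q m_infty (-1) (-1) 0 /\
    profile_limits c1 c2 u q p_infty (fst as_) (- fst as_) (- fst as_)).
  pose (pick := fun l => epsilon (inhabits (0, 0)) (Q l)).
  assert (HQ : forall l, 0 < l < l0 -> Q l (pick l)).
  { intros l Hl. apply epsilon_spec. destruct (first_wave l Hl) as [a [s H]]. exists (a, s). exact H. }
  exists l0. split; [exact Hl0|].
  exists (fun l => fst (pick l)), (fun l => - fst (pick l)), (fun l => - fst (pick l)),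
    (fun l => fst (pick l)), (fun l => - snd (pick l)), (fun l => snd (pick l)).
  split; [|split; [|split; [|split]]].
  - intros l Hl. destruct (HQ l Hl) as [c1 [c2 [u [q [c1d [c1dd [c2d [c2dd [_ [_ [Hs [Hwp [Lm Lp]]]]]]]]]]]]].
    set (a := fst (pick l)) in *. set (s := snd (pick l)) in *.
    exists (profile_state c1 c2 u q),
      (profile_state (fun z => - c2 (- z)) (fun z => - c1 (- z)) (fun z => u (- z)) (fun z => - q (- z))).
    split; [|split; [reflexivity | split; [reflexivity | split]]].
    + intros [|[|n]] _; apply stationary_state; lra.
    + intros [|[|[|n]]] Hn; try lia; simpl.
      * pose proof (wave_profile_traveling_wave _ _ _ _ _ _ _ _ _ _ _ _ _ _ _ _ Hwp Lm Lp) as H.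
        rewrite Ropp_0, Ropp_involutive in H. exact H.
      (* The reflection fixes the middle state, whose entries are [a], [- a], [- a] for [c1], [c2],
         [u1], and exchanges the two outer states. The mirrored wave thus starts where the first one
         ends. *)
      * pose proof (wave_profile_mirror _ _ _ _ _ _ _ _ _ _ (proj1 Hl) Hwp) as Hwp'.
        pose proof (profile_limits_mirror _ _ _ _ m_infty _ _ _ (or_introl eq_refl) Lp) as Lm'.
        pose proof (profile_limits_mirror _ _ _ _ p_infty _ _ _ (or_intror eq_refl) Lm) as Lp'.
        pose proof (wave_profile_traveling_wave _ _ _ _ _ _ _ _ _ _ _ _ _ _ _ _ Hwp' Lm' Lp') as H.
        rewrite !Ropp_involutive, Ropp_0 in H. replace (- -1) with 1 in H by ring. exact H.
    + intros [|[|n]] Hn; try lia; simpl. lra.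
  - apply (filterlim_at_right_of_abs_le _ _ K l0 Hl0 HK). intros l Hl.
    destruct (HQ l Hl) as [? [? [? [? [? [? [? [? [H _]]]]]]]]]. exact H.
  - apply (filterlim_at_right_of_abs_le _ _ K l0 Hl0 HK). intros l Hl.
    destruct (HQ l Hl) as [? [? [? [? [? [? [? [? [H _]]]]]]]]].
    replace (- fst (pick l) - - (1 / 2)) with (- (fst (pick l) - 1 / 2)) by ring.
    rewrite Rabs_Ropp. exact H.
  - apply (filterlim_at_right_of_abs_le _ _ K l0 Hl0 HK). intros l Hl.
    destruct (HQ l Hl) as [? [? [? [? [? [? [? [? [_ [H _]]]]]]]]]]. exact H.
  - apply (filterlim_at_right_of_abs_le _ _ K l0 Hl0 HK). intros l Hl.
    destruct (HQ l Hl) as [? [? [? [? [? [? [? [? [_ [H _]]]]]]]]]].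
    replace (- snd (pick l) - - (1 / 4)) with (- (snd (pick l) - 1 / 4)) by ring.
    rewrite Rabs_Ropp. exact H.
Qed.
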